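(* Let $\rho=\rho_{m_1}\oplus\cdots\oplus\rho_{m_s}$, with $m_1+\cdots+m_s=n+1$, be a quaternionic representation of $SU(2)$. If $M$ is a two-dimensional $\rho(SU(2))$-orbit in $\mathbf{HP}^n$, then there exist a point $[\mathbf z]\in M$ and a positive weight $\lambda$ such that $$\mathbf z=\sum_{\alpha=1}^s c_\alpha\,\mathbf u_{\lambda,\alpha},\qquad c_\alpha\in\mathbf C.$$
   Context: Quaternions: $\mathbf H$ has the standard units $\mathrm i,\mathrm j$, and $\mathbf C=\mathbf R+\mathbf R\mathrm i\subset\mathbf H$, so each quaternion is $a+b\mathrm j$ with $a,b\in\mathbf C$. $\mathbf H^{n+1}$ is the left $\mathbf H$-vector space of row vectors and $\mathbf{HP}^n$ is the set of (left) one-dimensional subspaces $[\mathbf z]=\mathbf H\mathbf z$. $Sp(m)=\{A\in M(m,\mathbf H):AA^*=I\}$. $SU(2)$ consists of $g=\begin{pmatrix}a&b\\-\bar b&\bar a\end{pmatrix}$, $|a|^2+|b|^2=1$. The representation $\rho_m$: for $m\ge1$ let $V_{2m-1}$ be the space of complex homogeneous polynomials of degree $2m-1$ in $z_0,z_1$, with basis $\mathbf v_k=z_0^kz_1^{2m-1-k}/\sqrt{k!(2m-1-k)!}$, $0\le k\le 2m-1$. Put $\lambda_k=2m-1-2k$; these are the weights. For $0\le k\le m-1$ set $\mathbf u_{\lambda_k}=\mathbf v_k$ and $\mathbf u_{-\lambda_k}=(-1)^k\mathrm i\,\mathbf v_{2m-1-k}$. Identify $V_{2m-1}$ with $\mathbf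 H^m$ by $$\sum_{k=0}^{m-1}(a_k\mathbf u_{\lambda_k}+b_k\mathbf u_{-\lambda_k})\mapsto(a_0+b_0\mathrm j,\ldots,a_{m-1}+b_{m-1}\mathrm j),\quad a_k,b_k\in\mathbf C.$$ For $g\in SU(2)$ let $(P\rho_m(g))(z_0,z_1)=P((z_0,z_1)g^{-1})=P(\bar az_0+\bar bz_1,-bz_0+az_1)$; under the identification this is right multiplication by a matrix $\rho_m(g)\in Sp(m)$, and $\rho_m(gh)=\rho_m(g)\rho_m(h)$. For $\rho=\rho_{m_1}\oplus\cdots\oplus\rho_{m_s}$ on $\mathbf H^{n+1}=\mathbf H^{m_1}\oplus\cdots\oplus\mathbf H^{m_s}$, $SU(2)$ acts on $\mathbf{HP}^n$ by $(g,P)\mapsto P\rho(g)$, and a $\rho(SU(2))$-orbit is an orbit of this action. A positive weight is a positive odd integer $\lambda$ with $\lambda\le 2m_\alpha-1$ for some $\alpha$. $\mathbf u_{\lambda,\alpha}$ denotes the vector $\mathbf u_\lambda$ in the $\alpha$-th summand $\mathbf H^{m_\alpha}$, with the convention that the corresponding term is $0$ if $\lambda>2m_\alpha-1$. *)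

(* Defs.v *)
From HB Require Import structures.
From mathcomp Require Import all_boot all_order all_algebra.
From mathcomp Require Import ring zify.
From mathcomp Require Import complex.
From mathcomp Require Import all_classical all_reals all_analysis.
(* The notations of mpoly clash with those of MathComp-Analysis. *)
From mathcomp Require Import -(notations) mpoly.

Set Implicit Arguments.
Unset Strict Implicit.
Unset Printing Implicit Defensive.

Import Order.TTheory GRing.Theory Num.Theory.
Import numFieldNormedType.Exports.

Local Open Scope classical_set_scope.
Local Open Scope complex_scope.
Local Open Scope ring_scope.

(* [Quat a b] is the quaternion a + b j, where j c = c^* j for c in C. *)
Record quaternion (R : rcfType) := Quat { qre : R[i]; qim : R[i] }.

Section QuaternionRing.
Variable R : rcfType.
Local Notation H := (quaternion R).
Implicit Types x y z : H.

Definition pair_of_quat x := (qre x, qim x).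
Definition quat_of_pair (p : R[i] * R[i]) : H := Quat p.1 p.2.

Fact pair_of_quatK : cancel pair_of_quat quat_of_pair.
Proof. by case. Qed.

HB.instance Definition _ := Choice.copy H (can_type pair_of_quatK).

Definition quat_zero : H := Quat 0 0.
Definition quat_one : H := Quat 1 0.
Definition quat_opp x : H := Quat (- qre x) (- qim x).
Definition quat_add x y : H := Quat (qre x + qre y) (qim x + qim y).
Definition quat_mul x y : H :=
  Quat (qre x * qre y - qim x * conjc (qim y))
       (qre x * qim y + qim x * conjc (qre y)).

Fact quat_addA : associative quat_add.
Proof. by move=> x y z; rewrite /quat_add /= !addrA. Qed.

Fact quat_addC : commutative quat_add.
Proof. by move=> x y; rewrite /quat_add addrC [qim x + _]addrC. Qed.

Fact quat_add0 : left_id quat_zero quat_add.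
Proof. by case=> a b; rewrite /quat_add /= !add0r. Qed.

Fact quat_addN : left_inverse quat_zero quat_opp quat_add.
Proof. by move=> x; rewrite /quat_add /= !addNr. Qed.

HB.instance Definition _ :=
  GRing.isZmodule.Build H quat_addA quat_addC quat_add0 quat_addN.

Fact quat_mulA : associative quat_mul.
Proof.
move=> x y z; rewrite /quat_mul /=.
by rewrite !(rmorphD, rmorphB, rmorphN, rmorphM) /= !conjcK; congr Quat; ring.
Qed.

Fact quat_mul1l : left_id quat_one quat_mul.
Proof. by case=> a b; rewrite /quat_mul /= !mul1r !mul0r subr0 addr0. Qed.

Fact quat_mul1r : right_id quat_one quat_mul.
Proof.
case=> a b; rewrite /quat_mul -[qim quat_one]/0 -[qre quat_one]/1.
by rewrite rmorph0 rmorph1 /= !mulr1 !mulr0 subr0 add0r.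
Qed.

Fact quat_mulDl : left_distributive quat_mul quat_add.
Proof. by move=> x y z; rewrite /quat_mul /quat_add /=; congr Quat; ring. Qed.

Fact quat_mulDr : right_distributive quat_mul quat_add.
Proof.
move=> x y z; rewrite /quat_mul /quat_add /= !rmorphD.
by congr Quat; ring.
Qed.

Fact quat_oner_neq0 : quat_one != quat_zero.
Proof. by apply/eqP; case=> /eqP; rewrite oner_eq0. Qed.

HB.instance Definition _ := GRing.Zmodule_isNzRing.Build H
  quat_mulA quat_mul1l quat_mul1r quat_mulDl quat_mulDr quat_oner_neq0.

Definition quat_of_complex (a : R[i]) : H := Quat a 0.

End QuaternionRing.

(** The representations of SU(2) *)

Definition SU2 (R : rcfType) : set 'M[R[i]]_2 :=
  [set g | exists a b : R[i], `|a| ^+ 2 + `|b| ^+ 2 = 1 /\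
     g = \matrix_(i < 2, j < 2)
           if i == 0 then (if j == 0 then a else b)
           else (if j == 0 then - conjc b else conjc a)].

Section Representation.
Variable R : rcfType.
Local Notation C := R[i].
Local Notation H := (quaternion R).

(* The exponent of the monomial z_0^k z_1^l. *)
Definition zexp (k l : nat) : multinom 2 := Multinom [tuple k; l].

Definition vnorm (d k : nat) : C := (Num.sqrt ((k`! * (d - k)`!)%:R : R))%:C.

(* v_k in the space V_d of homogeneous polynomials of degree d. *)
Definition vpoly (d k : nat) : mpoly 2 C :=
  (vnorm d k)^-1 *: mpolyX C (zexp k (d - k)).

(* The coordinate along v_k of an element of V_d. *)
Definition vcoef (d k : nat) (P : mpoly 2 C) : C :=
  vnorm d k * mcoeff (zexp k (d - k)) P.

Definition Vdeg (m : nat) : nat := (2 * m - 1)%N.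

(* [upos m k] and [uneg m k] are the vectors u_lambda and u_{-lambda} of
   V_{2m-1} for lambda = 2m - 1 - 2k and k < m. *)
Definition upos (m k : nat) : mpoly 2 C := vpoly (Vdeg m) k.
Definition uneg (m k : nat) : mpoly 2 C :=
  ((-1) ^+ k * 'i%C) *: vpoly (Vdeg m) (Vdeg m - k).

(* The identification of V_{2m-1} with H^m: [to_quat] is the inverse of
   [of_quat], see [of_quatK]. *)
Definition to_quat (m : nat) (P : mpoly 2 C) : 'rV[H]_m :=
  \row_(k < m) Quat (vcoef (Vdeg m) k P)
                    (vcoef (Vdeg m) (Vdeg m - k) P / ((-1) ^+ k * 'i%C)).

Definition of_quat (m : nat) (w : 'rV[H]_m) : mpoly 2 C :=
  \sum_(k < m) (qre (w 0 k) *: upos m k + qim (w 0 k) *: uneg m k).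

Fact vnorm_neq0 d k : vnorm d k != 0.
Proof.
rewrite /vnorm; apply/eqP => -[] /eqP.
by rewrite sqrtr_eq0 lern0 muln_eq0 !eqn0Ngt !fact_gt0.
Qed.

Fact vcoef_vpoly d i k : (i <= d)%N -> vcoef d i (vpoly d k) = (i == k)%:R.
Proof.
move=> id; rewrite /vcoef mcoeffZ mcoeffX.
have -> : (zexp k (d - k) == zexp i (d - i)) = (i == k).
  rewrite -val_eqE -val_eqE /= eqseq_cons eq_sym.
  by case: eqP => //= ->; rewrite eqxx.
case: eqP => [->|_]; last by rewrite !mulr0.
by rewrite mulr1 divff // vnorm_neq0.
Qed.

Fact vcoef_is_linear d k : linear_for *%R (vcoef d k).
Proof.
by move=> c P Q; rewrite /vcoef mcoeffD mcoeffZ mulrDr mulrCA.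
Qed.

Fact vcoef0 d k : vcoef d k 0 = 0.
Proof.
have := vcoef_is_linear d k (- 1) 0 0.
by rewrite addr0 scaler0 mulN1r addNr.
Qed.

Fact vcoef_of_quat m (w : 'rV[H]_m) i : (i <= Vdeg m)%N ->
  vcoef (Vdeg m) i (of_quat w) =
  \sum_(k < m) (qre (w 0 k) * (i == k)%:R +
    qim (w 0 k) * ((-1) ^+ k * 'i%C * (i == Vdeg m - k)%N%:R)).
Proof.
move=> iV; rewrite /of_quat; elim/big_rec2: _ => [|k x P _ <-].
  exact: vcoef0.
rewrite -addrA vcoef_is_linear vcoef_vpoly // vcoef_is_linear.
rewrite /uneg -[_ *: vpoly _ _]addr0 vcoef_is_linear vcoef_vpoly //.
by rewrite vcoef0 addr0 addrA.
Qed.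

Fact of_quatK m : cancel (@of_quat m) (@to_quat m).
Proof.
move=> w; apply/rowP => k; rewrite mxE.
have km := ltn_ord k; have kV : (k <= Vdeg m)%N by rewrite /Vdeg; lia.
rewrite !vcoef_of_quat ?leq_subr //.
have -> : \sum_(j < m) (qre (w 0 j) * (k == j :> nat)%:R +
    qim (w 0 j) * ((-1) ^+ j * 'i%C * (k == Vdeg m - j :> nat)%N%:R)) =
    qre (w 0 k).
  rewrite (bigD1 k) //= big1 => [|j /negPf jk].
    rewrite eqxx mulr1.
    case: eqP => [E|_]; last by rewrite !mulr0 !addr0.
    by move: E; rewrite /Vdeg; lia.
  rewrite eq_sym val_eqE jk mulr0 add0r.
  case: eqP => [E|_]; last by rewrite !mulr0.
  by have := ltn_ord j; move: E; rewrite /Vdeg; lia.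
have -> : \sum_(j < m) (qre (w 0 j) * ((Vdeg m - k)%N == j)%:R +
    qim (w 0 j) * ((-1) ^+ j * 'i%C * (Vdeg m - k == Vdeg m - j)%N%:R)) =
    qim (w 0 k) * ((-1) ^+ k * 'i%C).
  rewrite (bigD1 k) //= big1 => [|j /negPf jk].
    rewrite eqxx mulr1 addr0.
    case: eqP => [E|_]; last by rewrite mulr0 add0r.
    by move: E; rewrite /Vdeg; lia.
  have -> : (Vdeg m - k == Vdeg m - j)%N = false.
    rewrite -jk -val_eqE; apply/eqP/eqP => /= [|->] //.
    by have := ltn_ord j; rewrite /Vdeg; lia.
  rewrite !mulr0 addr0.
  case: eqP => [E|_]; last by rewrite mulr0.
  by have := ltn_ord j; move: E; rewrite /Vdeg; lia.
rewrite mulfK; first by case: (w 0 k).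
by rewrite mulf_neq0 ?signr_eq0 //; apply/eqP => -[] /eqP; rewrite oner_eq0.
Qed.

(* P |-> P((z_0, z_1) g^-1) *)
Definition SU2act (g : 'M[C]_2) (P : mpoly 2 C) : mpoly 2 C :=
  comp_mpoly [tuple \sum_(i < 2) invmx g i j *: mpolyX C (mnm1 i) | j < 2] P.

(* The k-th row is the image of the k-th vector of the canonical basis of H^m,
   which corresponds to u_{2m-1-2k}. *)
Definition rho (m : nat) (g : 'M[C]_2) : 'M[H]_m :=
  \matrix_(k < m) to_quat m (SU2act g (upos m k)).

(* The vector u_lambda of H^m for an odd lambda > 0, extended by 0 to
   lambda > 2m - 1. *)
Definition uvec (m lambda : nat) : 'rV[H]_m :=
  if (lambda <= Vdeg m)%N then to_quat m (upos m ((Vdeg m - lambda)./2)) else 0.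

End Representation.

Section DirectSum.
Variables (R : rcfType) (s : nat) (m : 'I_s -> nat) (N : nat).
Hypothesis hN : (\sum_(a < s) m a)%N = N.

Definition rho_sum (g : 'M[R[i]]_2) : 'M[quaternion R]_N :=
  castmx (hN, hN) (\mxdiag_(a < s) rho (m a) g).

Definition uvec_sum (lambda : nat) (a : 'I_s) : 'rV[quaternion R]_N :=
  castmx (erefl 1%N, hN)
    (\mxrow_(b < s) if b == a then uvec R (m b) lambda else 0).

End DirectSum.

Definition positive_weight (s : nat) (m : 'I_s -> nat) (lambda : nat) : Prop :=
  odd lambda /\ exists a, (lambda <= 2 * m a - 1)%N.

(** Quaternionic projective space *)

Section ProjectiveSpace.
Variables (R : rcfType) (N : nat).
Local Notation H := (quaternion R).

Definition hline (z : 'rV[H]_N) : set 'rV[H]_N := [set q *: z | q in setT].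

(* The set of left lines of H^N, that is HP^(N - 1). *)
Definition HP : set (set 'rV[H]_N) := [set hline z | z in [set z | z != 0]].

(* An orbit of the action (g, P) |-> P r(g) of SU(2) on HP^(N - 1). *)
Definition is_orbit (r : 'M[R[i]]_2 -> 'M[H]_N) (M : set (set 'rV[H]_N)) :=
  exists2 P, HP P & M = [set [set w *m r g | w in P] | g in @SU2 R].

End ProjectiveSpace.

(** Smooth submanifolds *)

Section Submanifold.
Variable R : realType.

Fixpoint Ck (V W : normedModType R) (k : nat) (U : set V) (f : V -> W) : Prop :=
  if k is k'.+1 then
    (forall x, U x -> differentiable f x) /\
    (forall v, Ck k' U (fun x => 'd f x v))
  else forall x, U x -> {for x, continuous f}.

Definition smooth (V W : normedModType R) (U : set V) (f : V -> W) : Prop :=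
  forall k, Ck k U f.

(* S is an embedded d-dimensional smooth submanifold of V: each point of S has
   an open neighbourhood A such that S `&` A is the image of an open subset of
   R^d under a smooth immersion that is a homeomorphism onto S `&` A. *)
Definition submanifold (V : normedModType R) (d : nat) (S : set V) : Prop :=
  forall x, S x ->
  exists (U : set 'rV[R]_d) (A : set V) (phi : 'rV[R]_d -> V)
         (psi : V -> 'rV[R]_d),
    [/\ open U, open A /\ A x, smooth U phi,
        forall u, U u -> injective ('d phi u) &
        [/\ phi @` U = S `&` A, {in U, cancel phi psi} &
            {within S `&` A, continuous psi}]].

Variable N : nat.
Local Notation H := (quaternion R).

(* The identification of R^4 with H. *)
Definition quat_of_reals (x : 'rV[R]_4) : H :=
  Quat (x 0 0 +i* x 0 1) (x 0 2 +i* x 0 3).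

(* The vector of H^N with i-th coordinate 1 and the other ones given by x in
   H^(N - 1) = R^(4(N - 1)): x |-> [affine_point i x] is the inverse of the
   i-th affine chart of HP^(N - 1). *)
Definition affine_point (i : 'I_N) (x : 'M[R]_(N.-1, 4)) : 'rV[H]_N :=
  \row_j if unlift i j is Some k then quat_of_reals (row k x) else 1.

(* M is an embedded d-dimensional smooth submanifold of HP^(N - 1): its traces
   in the affine charts are submanifolds of H^(N - 1). *)
Definition HP_submanifold (d : nat) (M : set (set 'rV[H]_N)) : Prop :=
  M `<=` @HP R N /\
  forall i, submanifold d [set x | M (hline (affine_point i x))].

End Submanifold.

(* Main.v *)
(* Normalise the i-th coordinate of z to 1, and let X run over a basis of su(2)
   in the curves [z rho(exp (t X))] of the orbit M. Their velocities in the i-th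
   affine chart are linear in X and lie in the image of the differential of a
   parametrisation of M, which has dimension 2; hence some unit X is sent to 0,
   that is, z d rho(X) = q z for some quaternion q. Conjugating X to diag (i, -i)
   replaces z by a point w of the same orbit such that w D = q' w, where
   D = d rho(diag (i, -i)) is diagonal with entries i lambda_k, one for each
   u_{lambda_k}. Normalising a coordinate of w to 1 makes q' = i lambda, and
   w_k i lambda_k = i lambda w_k leaves only complex coordinates of weight
   lambda. *)

Require Import Defs.
From mathcomp Require Import all_boot all_order all_algebra.
From mathcomp Require Import ring lra zify.
From mathcomp Require Import complex.
From mathcomp Require Import all_classical all_reals all_analysis.
From mathcomp Require Import -(notations) mpoly.

Set Implicit Arguments.
Unset Strict Implicit.
Unset Printing Implicit Defensive.

Import Order.TTheory GRing.Theory Num.Theory.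
Import numFieldNormedType.Exports.

Local Open Scope classical_set_scope.
Local Open Scope complex_scope.
Local Open Scope ring_scope.

(** * Substitutions in binary forms and the representations of SU(2) *)

Section BinaryForms.
Variable R : rcfType.
Local Notation C := R[i].
Local Notation H := (quaternion R).
Local Notation P2 := (mpoly 2 C).
Local Notation X0 := (mpolyX C (mnm1 (0 : 'I_2))).
Local Notation X1 := (mpolyX C (mnm1 (1 : 'I_2))).

(** Two obstacles shape the proof. The rows of [rho] record only the images of the vectors of
    positive weight, that is, of half of a complex basis. That [rho] is multiplicative, which is
    needed to move from z to z rho(h), therefore rests on the commutation of the action with the
    quaternionic structure P |-> i conj(P)(- z_1, z_0). Moreover, a submanifold is given by
    parametrisations whose inverses are merely continuous, so that the tangency of the curves of the
    orbit has to be proved by hand. No matrix exponential or general Lie theory enters. A unit X in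
    su(2) satisfies X^2 = - 1, so its one-parameter group is cos t + sin t X; [drho] is an explicit
    formula; and its behaviour under conjugation is found by differentiating an identity of the
    group. These curves exist for unit X only: tangency is used for three basis vectors, and the
    kernel direction found by linearity is normalised afterwards. *)

Lemma mpolyX2E (k l : nat) : mpolyX C (zexp k l) = X0 ^+ k * X1 ^+ l.
Proof.
rewrite mpolyXE_id big_ord_recl big_ord1.
by congr (_ * mpolyX C (mnm1 _) ^+ _); apply/val_inj.
Qed.

Lemma zexpE (k : multinom 2) : k = zexp (k 0) (k 1).
Proof.
apply/mnmP => i; rewrite [RHS](mnm_nth 0) /=.
by case: i => -[|[|//]] p /=; congr (fun_of_multinom k _); apply/val_inj.
Qed.

Local Notation comp2 p q := (comp_mpoly [tuple p; q]).

Lemma comp2X (p q : P2) k l : comp2 p q (mpolyX C (zexp k l)) = p ^+ k * q ^+ l.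
Proof.
rewrite comp_mpolyX big_ord_recl big_ord1 !(tnth_nth 0).
by rewrite ![zexp _ _ _](mnm_nth 0%N).
Qed.

Lemma comp2E (p q P : P2) :
  comp2 p q P = \sum_(k <- msupp P) mcoeff k P *: (p ^+ k 0 * q ^+ k 1).
Proof.
rewrite comp_mpolyE; apply: eq_bigr => k _; congr (_ *: _).
rewrite big_ord_recl big_ord1 !(tnth_nth 0) /=.
by congr (_ * _ ^+ fun_of_multinom k _); apply/val_inj.
Qed.

Lemma comp2X0 (p q : P2) : comp2 p q X0 = p.
Proof. by rewrite comp_mpolyXU. Qed.
Lemma comp2X1 (p q : P2) : comp2 p q X1 = q.
Proof. by rewrite comp_mpolyXU. Qed.

Lemma comp2_comp (p q r s P : P2) :
  comp2 p q (comp2 r s P) = comp2 (comp2 p q r) (comp2 p q s) P.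
Proof.
rewrite (comp2E r s) [RHS]comp2E (raddf_sum (comp2 p q)).
by apply: eq_bigr => k _; rewrite /= linearZ /= rmorphM !rmorphXn.
Qed.

Lemma comp2_id (P : P2) : comp2 X0 X1 P = P.
Proof.
rewrite comp2E [RHS]mpolyE; apply: eq_bigr => k _.
by rewrite -mpolyX2E -zexpE.
Qed.

Lemma eq_mpoly2 (P Q : P2) :
  (forall k l, mcoeff (zexp k l) P = mcoeff (zexp k l) Q) -> P = Q.
Proof. by move=> PQ; apply/mpolyP => k; rewrite (zexpE k). Qed.

Local Notation homog d := (ishomog1 d (@mdeg 2 : measure 2)).

Lemma dhomogX2 d (k l : nat) :
  (mpolyX C (zexp k l) \is homog d) = (k + l == d)%N.
Proof.
by rewrite dhomogX /= mdegE big_ord_recl big_ord1 ![zexp _ _ _](mnm_nth 0%N).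
Qed.

Lemma homog_vpoly d k : (k <= d)%N -> vpoly R d k \is homog d.
Proof. by move=> kd; rewrite dhomogZ // dhomogX2 subnKC. Qed.

Lemma comp2_homog d (p q P : P2) : p \is homog 1 -> q \is homog 1 ->
  P \is homog d -> comp2 p q P \is homog d.
Proof.
move=> hp hq hP; rewrite comp2E rpred_sum // => k _.
have [kd|kd] := eqVneq (mdeg k) d; last first.
  by rewrite (dhomog_nemf_coeff hP kd) scale0r rpred0.
rewrite dhomogZ //.
have -> : d = (1 * k 0%R + 1 * k 1%R)%N.
  rewrite -kd mdegE big_ord_recl big_ord1 !mul1n.
  by congr (_ + fun_of_multinom k _)%N; apply/val_inj.
by apply: dhomogM; exact: dhomogMn.
Qed.

End BinaryForms.

(** * The action of SU(2) on binary forms and its quaternionic structure *)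

Section SU2.
Variable R : rcfType.
Local Notation C := R[i].
Local Notation P2 := (mpoly 2 C).
Local Notation X0 := (mpolyX C (mnm1 (0 : 'I_2))).
Local Notation X1 := (mpolyX C (mnm1 (1 : 'I_2))).
Local Notation comp2 p q := (comp_mpoly [tuple p; q]).
Local Notation homog d := (ishomog1 d (@mdeg 2 : measure 2)).

Lemma conjcD : {morph @conjc R : x y / x + y}. Proof. exact: rmorphD. Qed.
Lemma conjcN : {morph @conjc R : x / - x}. Proof. exact: rmorphN. Qed.
Lemma conjcM : {morph @conjc R : x y / x * y}. Proof. exact: rmorphM. Qed.
Lemma conjci : conjc 'i%C = - 'i%C :> C.
Proof. by apply/eqP; rewrite eq_complex /= oppr0 !eqxx. Qed.

Let conjE := (conjcD, conjcN, conjcM, @conjcK R, @conjc1 R, @conjc0 R).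

Definition su2 (a b : C) : 'M[C]_2 := \matrix_(i < 2, j < 2)
  if i == 0 then (if j == 0 then a else b)
  else (if j == 0 then - conjc b else conjc a).

Lemma SU2P (g : 'M[C]_2) :
  SU2 g <-> exists a b, a * conjc a + b * conjc b = 1 /\ g = su2 a b.
Proof.
by split=> -[a [b [ab ->]]]; exists a, b; move: ab; rewrite !sqr_normc.
Qed.

Lemma su2M a b c d :
  su2 a b *m su2 c d = su2 (a * c - b * conjc d) (a * d + b * conjc c).
Proof.
apply/matrixP => i j; rewrite !mxE big_ord_recl big_ord1 !mxE /=.
case: ifP => _; case: ifP => _;
  by rewrite ?conjE; ring.
Qed.

Lemma su2_1 : su2 1 0 = 1%:M.
Proof.
apply/matrixP => i j; rewrite !mxE ?conjE.
by case: i j => -[|[|//]] p [[|[|//]] q] //=; rewrite ?oppr0.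
Qed.

Lemma su2_unit a b : a * conjc a + b * conjc b = 1 ->
  su2 a b \in unitmx /\ invmx (su2 a b) = su2 (conjc a) (- b).
Proof.
move=> ab; have ab1 : su2 a b *m su2 (conjc a) (- b) = 1%:M.
  rewrite su2M -su2_1 !conjE; congr su2; last by ring.
  by rewrite mulrN opprK.
have /mulmx1_unit [u _] := ab1; split=> //.
by rewrite -[RHS](mulKmx u) ab1 mulmx1.
Qed.

Lemma su2_act a b (P : P2) : a * conjc a + b * conjc b = 1 ->
  SU2act (su2 a b) P =
  comp2 (conjc a *: X0 + conjc b *: X1) (- b *: X0 + a *: X1) P.
Proof.
move=> ab; rewrite /SU2act (su2_unit ab).2; congr (comp_mpoly _ P).
apply: eq_from_tnth => j; rewrite tnth_mktuple big_ord_recl big_ord1 !mxE /=.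
have -> : lift ord0 ord0 = 1 :> 'I_2 by apply/val_inj.
rewrite (tnth_nth 0); case: j => -[|[|//]] p /=.
  by rewrite conjE opprK.
by rewrite conjE.
Qed.

Lemma lin2_homog (a b : C) : a *: X0 + b *: X1 \is homog 1.
Proof. by rewrite dhomogD // dhomogZ // dhomogX /= mdeg1. Qed.

Lemma comp2_lin (p q : P2) a b :
  comp2 p q (a *: X0 + b *: X1) = a *: p + b *: q.
Proof. by rewrite linearD !linearZ /= comp2X0 comp2X1. Qed.

Lemma SU2act_homog g d (P : P2) :
  SU2 g -> P \is homog d -> SU2act g P \is homog d.
Proof.
move=> /SU2P [a [b [ab ->]]] hP; rewrite su2_act //.
by apply: comp2_homog hP; exact: lin2_homog.
Qed.

Lemma SU2act1 (P : P2) : SU2act 1%:M P = P.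
Proof.
rewrite -su2_1 su2_act; last by rewrite !conjE; ring.
by rewrite !conjE oppr0 !scale0r !scale1r addr0 add0r comp2_id.
Qed.

(** Substituting z h^-1 for z in P (z g^-1) gives P (z h^-1 g^-1) = P (z (g h)^-1): this is a right
    action, in accordance with row vectors multiplied by matrices on the right. *)
Lemma SU2actM g h (P : P2) : SU2 g -> SU2 h ->
  SU2act h (SU2act g P) = SU2act (g *m h) P.
Proof.
move=> /SU2P [a [b [ab ->]]] /SU2P [c [d [cd ->]]].
(* The norm is multiplicative: the left side is the product of those of [ab] and [cd]. *)
have cdab : (a * c - b * conjc d) * conjc (a * c - b * conjc d) +
   (a * d + b * conjc c) * conjc (a * d + b * conjc c) = 1.
  rewrite !conjE -[RHS](mulr1 1) -{1}ab -cd; ring.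
rewrite su2M (su2_act _ ab) (su2_act _ cd) (su2_act _ cdab) comp2_comp.
congr (comp_mpoly _ P).
rewrite !comp2_lin.
rewrite !conjE.
by congr [tuple of [:: _; _]]; apply: eq_mpoly2 => k l;
  rewrite !(mcoeffD, mcoeffZ); ring.
Qed.

(* The quaternionic structure: left multiplication by j on H^m. *)
Definition J2 (P : P2) : P2 := 'i%C *: comp2 (- X1) X0 (map_mpoly conjc P).

(** The shape of the matrices of SU(2) enters here: conj(g) = W g W^-1 for W with rows (0, 1) and (-
    1, 0), so the antilinear substitution [J2] commutes with that of g. *)
Lemma SU2act_J2 g (P : P2) : SU2 g -> SU2act g (J2 P) = J2 (SU2act g P).
Proof.
move=> /SU2P [a [b [ab ->]]]; rewrite !(su2_act _ ab) /J2.
rewrite [LHS]linearZ /= map_mpoly_comp; last exact: can_inj (@conjcK R).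
set L := [tuple of [seq _ | q <- _]].
have -> : L = [tuple a *: X0 + b *: X1; - conjc b *: X0 + conjc a *: X1].
  apply: eq_from_tnth => i; rewrite !(tnth_nth 0).
  by case: i => -[|[|//]] p /=;
    rewrite raddfD /= !map_mpolyZ !map_mpolyX /= !conjE.
rewrite !comp2_comp linearN /= !comp2_lin comp2X0 comp2X1.
have -> : - (- b *: X0 + a *: X1) = a *: - X1 + b *: X0 :> P2.
  apply: eq_mpoly2 => k l; rewrite !(mcoeffN, mcoeffD, mcoeffZ); ring.
have -> : conjc a *: X0 + conjc b *: X1 =
    - conjc b *: - X1 + conjc a *: X0 :> P2.
  apply: eq_mpoly2 => k l; rewrite !(mcoeffN, mcoeffD, mcoeffZ); ring.
by [].
Qed.

End SU2.

(** * Quaternionic linearity of the action and multiplicativity of [rho] *)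

Section RhoMorphism.
Variable R : rcfType.
Local Notation C := R[i].
Local Notation H := (quaternion R).
Local Notation P2 := (mpoly 2 C).
Local Notation X0 := (mpolyX C (mnm1 (0 : 'I_2))).
Local Notation X1 := (mpolyX C (mnm1 (1 : 'I_2))).
Local Notation comp2 p q := (comp_mpoly [tuple p; q]).
Local Notation homog d := (ishomog1 d (@mdeg 2 : measure 2)).
Local Notation qc := (@quat_of_complex R).
Local Notation qj := (Quat 0 1 : H).

Lemma quatP (x y : H) : qre x = qre y -> qim x = qim y -> x = y.
Proof. by case: x y => a b [c d] /= -> ->. Qed.

Lemma qreD (x y : H) : qre (x + y) = qre x + qre y. Proof. by []. Qed.
Lemma qimD (x y : H) : qim (x + y) = qim x + qim y. Proof. by []. Qed.
Lemma qreM (x y : H) : qre (x * y) = qre x * qre y - qim x * conjc (qim y).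
Proof. by []. Qed.
Lemma qimM (x y : H) : qim (x * y) = qre x * qim y + qim x * conjc (qre y).
Proof. by []. Qed.

Lemma quatE (x : H) : x = qc (qre x) + qc (qim x) * qj.
Proof.
apply: quatP; rewrite ?(qreD, qimD, qreM, qimM) /= ?conjc0 ?conjc1.
  by rewrite !(mul0r, mulr0, subr0, addr0, mulr1).
by rewrite !(mul0r, mulr0, subr0, addr0, add0r, mulr1).
Qed.

Lemma J2D (P Q : P2) : J2 (P + Q) = J2 P + J2 Q.
Proof. by rewrite /J2 raddfD /= linearD /= scalerDr. Qed.

Lemma J2Z (c : C) (P : P2) : J2 (c *: P) = conjc c *: J2 P.
Proof. by rewrite /J2 map_mpolyZ linearZ /= !scalerA mulrC. Qed.

Lemma J2_0 : J2 0 = 0 :> P2.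
Proof. by rewrite /J2 raddf0 linear0 scaler0. Qed.

Lemma vnorm_conj d k : conjc (vnorm R d k) = vnorm R d k.
Proof. by rewrite /vnorm conjc_real. Qed.

Lemma mul_signr_mpoly k (P : P2) : (-1) ^+ k * P = (-1) ^+ k *: P.
Proof. by rewrite -signr_odd -[in RHS]signr_odd mulr_sign scaler_sign. Qed.

Lemma J2_vpoly d k : (k <= d)%N ->
  J2 (vpoly R d k) = ((-1) ^+ k * 'i%C) *: vpoly R d (d - k).
Proof.
move=> kd; rewrite /vpoly J2Z scalerA conjc_inv vnorm_conj.
have -> : vnorm R d (d - k) = vnorm R d k by rewrite /vnorm subKn // mulnC.
rewrite /J2 map_mpolyX comp2X subKn // !mpolyX2E (exprNn X1) -mulrA.
rewrite [X1 ^+ k * _]mulrC.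
rewrite mul_signr_mpoly !scalerA.
by congr (_ *: _); ring.
Qed.
Lemma J2_upos m k : (k < m)%N -> J2 (upos R m k) = uneg R m k.
Proof. by move=> km; rewrite J2_vpoly //; rewrite /Vdeg; lia. Qed.

(** The signs of [J2_vpoly] at k and at [Vdeg m - k] multiply to (-1)^(2m - 1) = - 1: [J2] squares
    to - 1 because the degree is odd. *)
Lemma J2_uneg m k : (k < m)%N -> J2 (uneg R m k) = - upos R m k.
Proof.
move=> km; have kV : (k <= Vdeg m)%N by rewrite /Vdeg; lia.
rewrite /uneg J2Z J2_vpoly ?leq_subr // subKn // scalerA -[RHS]scaleN1r.
congr (_ *: vpoly _ _ _).
have -> : conjc ((-1) ^+ k * 'i%C) = (-1) ^+ k * - 'i%C :> C.
  rewrite conjcM rmorphXn rmorphN1; congr (_ * _); exact: conjci.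
rewrite mulrACA -exprD subnKC // mulNr -expr2 sqr_i opprK mulr1.
by rewrite -signr_odd /Vdeg oddB ?oddM //; lia.
Qed.

Lemma J2_sum (I : Type) (r : seq I) (F : I -> P2) :
  J2 (\sum_(i <- r) F i) = \sum_(i <- r) J2 (F i).
Proof. exact: (big_morph _ J2D J2_0). Qed.

Lemma of_quat_j m (w : 'rV[H]_m) : of_quat (qj *: w) = J2 (of_quat w).
Proof.
rewrite /of_quat J2_sum; apply: eq_bigr => k _.
rewrite J2D (J2Z _ (upos R m k)) (J2Z _ (uneg R m k)) J2_upos // J2_uneg //.
rewrite !mxE qreM qimM /= !mul0r !mul1r sub0r add0r.
by rewrite scalerN scaleNr addrC.
Qed.

Lemma to_quatD m (P Q : P2) : to_quat m (P + Q) = to_quat m P + to_quat m Q.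
Proof.
apply/rowP => k; rewrite !mxE; apply: quatP; rewrite ?qreD ?qimD /=;
by rewrite -[P]scale1r vcoef_is_linear mul1r ?scale1r ?mulrDl.
Qed.

Lemma to_quatZ m c (P : P2) : to_quat m (c *: P) = qc c *: to_quat m P.
Proof.
apply/rowP => k; rewrite !mxE; apply: quatP; rewrite ?qreM ?qimM /=;
by rewrite -[_ *: _]addr0 vcoef_is_linear vcoef0 !mul0r addr0
  ?subr0 ?mulrA ?addr0.
Qed.

(** [to_quat] reads the 2m coefficients in degree 2m - 1 and no others, hence the homogeneity. For m
    = 0 the truncated degree [Vdeg 0] is 0, and the nonzero constants would be lost. *)
Lemma to_quat_inj m (P Q : P2) : (1 <= m)%N ->
  P \is homog (Vdeg m) -> Q \is homog (Vdeg m) ->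
  to_quat m P = to_quat m Q -> P = Q.
Proof.
move=> m1 hP hQ PQ; apply: eq_mpoly2 => k l.
have [kl|kl] := eqVneq (k + l)%N (Vdeg m); last first.
  have kl' : mdeg (zexp k l) != Vdeg m.
    by rewrite mdegE big_ord_recl big_ord1 ![zexp _ _ _](mnm_nth 0%N).
  by rewrite (dhomog_nemf_coeff hP kl') (dhomog_nemf_coeff hQ kl').
have vPQ i : (i <= Vdeg m)%N -> vcoef (Vdeg m) i P = vcoef (Vdeg m) i Q.
  move=> iV; have [im|im] := ltnP i m.
    have := congr1 (fun w : 'rV_m => w 0 (Ordinal im)) PQ.
    by rewrite !mxE => -[].
  have im' : (Vdeg m - i < m)%N by move: im iV; rewrite /Vdeg; lia.
  have := congr1 (fun w : 'rV_m => w 0 (Ordinal im')) PQ; rewrite !mxE => -[_].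
  rewrite subKn // => /(divIf _); apply.
  by rewrite mulf_neq0 ?signr_eq0 //; apply/eqP => -[] /eqP; rewrite oner_eq0.
have kV : (k <= Vdeg m)%N by rewrite -kl leq_addr.
have -> : l = (Vdeg m - k)%N by rewrite -kl addKn.
exact: mulfI (vnorm_neq0 _ _ _) _ _ (vPQ k kV).
Qed.

Lemma of_quat_homog m (w : 'rV[H]_m) : of_quat w \is homog (Vdeg m).
Proof.
rewrite /of_quat rpred_sum // => k _; have km := ltn_ord k.
by apply: dhomogD; apply: dhomogZ; [|apply: dhomogZ]; apply: homog_vpoly;
  rewrite /Vdeg; lia.
Qed.

Lemma to_quatK m (P : P2) : (1 <= m)%N -> P \is homog (Vdeg m) ->
  of_quat (to_quat m P) = P.
Proof.
move=> m1 hP; apply: (to_quat_inj m1) (of_quat_homog _) hP _.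
by rewrite of_quatK.
Qed.

Lemma upos_homog m k : (k < m)%N -> upos R m k \is homog (Vdeg m).
Proof. by move=> km; apply: homog_vpoly; rewrite /Vdeg; lia. Qed.

Lemma to_quat_J2 m (P : P2) : (1 <= m)%N -> P \is homog (Vdeg m) ->
  to_quat m (J2 P) = qj *: to_quat m P.
Proof. by move=> m1 hP; rewrite -{1}(to_quatK m1 hP) -of_quat_j of_quatK. Qed.

Lemma to_quat_sum m (I : Type) (r : seq I) (F : I -> P2) :
  to_quat m (\sum_(i <- r) F i) = \sum_(i <- r) to_quat m (F i).
Proof.
apply: (big_morph _ (@to_quatD m)).
have := to_quatZ m 0 0; rewrite scale0r => ->.
by apply/rowP => i; rewrite !mxE mul0r.
Qed.

Lemma SU2act_sum g (I : Type) (r : seq I) (F : I -> P2) :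
  SU2act g (\sum_(i <- r) F i) = \sum_(i <- r) SU2act g (F i).
Proof. exact: raddf_sum. Qed.

Lemma SU2act_lin2 g c d (P Q : P2) :
  SU2act g (c *: P + d *: Q) = c *: SU2act g P + d *: SU2act g Q.
Proof. by rewrite /SU2act linearD !linearZ. Qed.

(** The rows of [rho] give the images of the u_lambda with lambda > 0; those of u_{-lambda} = J
    u_lambda follow, since the action commutes with J, which is left multiplication by j. *)
Lemma to_quat_act m g (w : 'rV[H]_m) : (1 <= m)%N -> SU2 g ->
  to_quat m (SU2act g (of_quat w)) = w *m rho m g.
Proof.
move=> m1 gS; rewrite mulmx_sum_row /of_quat SU2act_sum to_quat_sum.
apply: eq_bigr => k _; rewrite SU2act_lin2 -J2_upos // SU2act_J2 //.
rewrite to_quatD 2!to_quatZ to_quat_J2 //.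
  by rewrite rowK scalerA -scalerDl -quatE.
by apply: SU2act_homog => //; exact: upos_homog.
Qed.

Lemma row_rho m (g : 'M[C]_2) (k : 'I_m) :
  row k (@rho R m g) = to_quat m (SU2act g (upos R m k)).
Proof. exact: rowK. Qed.

Lemma rhoM m (g h : 'M[C]_2) : (1 <= m)%N -> SU2 g -> SU2 h ->
  @rho R m (g *m h) = @rho R m g *m @rho R m h.
Proof.
move=> m1 gS hS; apply/row_matrixP => k.
apply: etrans _ (esym (row_mul _ _ _)).
have hP : SU2act g (upos R m k) \is homog (Vdeg m).
  by apply: SU2act_homog gS _; exact: upos_homog.
have := to_quat_act (to_quat m (SU2act g (upos R m k))) m1 hS.
rewrite (to_quatK m1 hP) (SU2actM _ gS hS) => e.
apply: etrans (etrans (row_rho (g *m h) k) e) _.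
exact: (congr1 (mulmx^~ _) (esym (row_rho _ _))).
Qed.

Lemma to_quat_upos m (k : 'I_m) : to_quat m (upos R m k) = delta_mx 0 k.
Proof.
rewrite -[RHS](@of_quatK R); congr to_quat.
rewrite /of_quat (bigD1 k) //= big1 => [|i /negPf ik].
  by rewrite !mxE !eqxx /= scale1r scale0r !addr0.
by rewrite !mxE ik andbF /= !scale0r addr0.
Qed.

Lemma rho1 m : @rho R m 1%:M = 1%:M.
Proof.
by apply/row_matrixP => k; rewrite row_rho SU2act1 to_quat_upos row1.
Qed.

End RhoMorphism.

(** * Derivatives at 0 of complex, quaternionic and polynomial curves *)

Section CurveDerivatives.
Variable R : realType.
Local Notation C := R[i].
Local Notation H := (quaternion R).
Local Notation P2 := (mpoly 2 C).
Local Notation X0 := (mpolyX C (mnm1 (0 : 'I_2))).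
Local Notation X1 := (mpolyX C (mnm1 (1 : 'I_2))).

Local Notation Re := (@complex.Re R).
Local Notation Im := (@complex.Im R).

(* All the derivatives are at t = 0, componentwise for non-real values. *)
Definition rder (f : R -> R) (p : R) := is_derive (0 : R) (1 : R) f p.

Lemma rder_eq f g p q : f =1 g -> p = q -> rder f p -> rder g q.
Proof. by move=> /funext -> ->. Qed.

Lemma rder_cst c : rder (fun=> c) 0.
Proof. exact: is_derive_cst. Qed.

Lemma rderD f g p q : rder f p -> rder g q -> rder (fun t => f t + g t) (p + q).
Proof. by move=> hf hg; exact: is_deriveD. Qed.

Lemma rderN f p : rder f p -> rder (fun t => - f t) (- p).
Proof. by move=> hf; exact: is_deriveN. Qed.

Lemma rderM f g p q : rder f p -> rder g q ->
  rder (fun t => f t * g t) (p * g 0 + f 0 * q).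
Proof.
move=> hf hg; apply: is_derive_eq (is_deriveM hf hg) _.
by rewrite addrC /GRing.scale /= [g 0 * p]mulrC.
Qed.

Lemma rderV f p : f 0 != 0 -> rder f p ->
  rder (fun t => (f t)^-1) (- p / f 0 ^+ 2).
Proof.
move=> f0 [df <-]; apply: DeriveDef; first exact: derivableV.
by rewrite deriveV // /GRing.scale /= mulNr mulrC mulNr.
Qed.

Lemma rder_uniq f p q : rder f p -> rder f q -> p = q.
Proof. by move=> [_ <-] [_ <-]. Qed.

Lemma rder_continuous f p : rder f p -> f t @[t --> (0 : R)] --> f 0.
Proof.
by move=> [df _]; apply/differentiable_continuous/derivable1_diffP.
Qed.

Definition cder (f : R -> C) (p : C) :=
  rder (fun t => Re (f t)) (Re p) /\ rder (fun t => Im (f t)) (Im p).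

Lemma ReD (x y : C) : Re (x + y) = Re x + Re y.
Proof. by case: x => ? ?; case: y. Qed.
Lemma ImD (x y : C) : Im (x + y) = Im x + Im y.
Proof. by case: x => ? ?; case: y. Qed.
Lemma ReM (x y : C) : Re (x * y) = Re x * Re y - Im x * Im y.
Proof. by case: x => ? ?; case: y. Qed.
Lemma ImM (x y : C) : Im (x * y) = Re x * Im y + Im x * Re y.
Proof. by case: x => ? ?; case: y. Qed.
Lemma ReN (x : C) : Re (- x) = - Re x.
Proof. by case: x. Qed.
Lemma ImN (x : C) : Im (- x) = - Im x.
Proof. by case: x. Qed.
Lemma ReJ (x : C) : Re (conjc x) = Re x. Proof. by case: x. Qed.
Lemma ImJ (x : C) : Im (conjc x) = - Im x. Proof. by case: x. Qed.
Let ReImE := (ReD, ImD, ReM, ImM, ReN, ImN, ReJ, ImJ).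

Lemma cder_eq f g p q : f =1 g -> p = q -> cder f p -> cder g q.
Proof. by move=> /funext -> ->. Qed.

Lemma cder_cst c : cder (fun=> c) 0.
Proof. by split; exact: rder_cst. Qed.

Lemma cderD f g p q : cder f p -> cder g q -> cder (fun t => f t + g t) (p + q).
Proof.
move=> [f1 f2] [g1 g2]; split.
  by under eq_fun do rewrite ReD; rewrite ReD; exact: rderD.
by under eq_fun do rewrite ImD; rewrite ImD; exact: rderD.
Qed.

Lemma cderN f p : cder f p -> cder (fun t => - f t) (- p).
Proof.
move=> [f1 f2]; split.
  by under eq_fun do rewrite ReN; rewrite ReN; exact: rderN.
by under eq_fun do rewrite ImN; rewrite ImN; exact: rderN.
Qed.

Lemma cderJ f p : cder f p -> cder (fun t => conjc (f t)) (conjc p).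
Proof.
move=> [f1 f2]; split.
  by under eq_fun do rewrite ReJ; rewrite ReJ.
by under eq_fun do rewrite ImJ; rewrite ImJ; exact: rderN.
Qed.

Lemma cderM f g p q : cder f p -> cder g q ->
  cder (fun t => f t * g t) (p * g 0 + f 0 * q).
Proof.
move=> [f1 f2] [g1 g2]; split.
  under eq_fun do rewrite ReM.
  have := rderD (rderM f1 g1) (rderN (rderM f2 g2)).
  by congr rder; rewrite !ReImE; ring.
under eq_fun do rewrite ImM.
have := rderD (rderM f1 g2) (rderM f2 g1).
by congr rder; rewrite !ReImE; ring.
Qed.

Lemma cder_uniq f p q : cder f p -> cder f q -> p = q.
Proof.
move=> [p1 p2] [q1 q2]; apply/eqP.
by rewrite eq_complex (rder_uniq p1 q1) (rder_uniq p2 q2) !eqxx.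
Qed.

Lemma cder_sum (I : Type) (r : seq I) (P : pred I)
    (f : I -> R -> C) (p : I -> C) :
  (forall i, cder (f i) (p i)) ->
  cder (fun t => \sum_(i <- r | P i) f i t) (\sum_(i <- r | P i) p i).
Proof.
move=> fp; elim: r => [|i r IH].
  by under eq_fun do rewrite big_nil; rewrite big_nil; exact: cder_cst.
under eq_fun do rewrite big_cons; rewrite big_cons.
by case: (P i) => //; exact: cderD.
Qed.

Lemma cder_real f p : rder f p -> cder (fun t => (f t)%:C) p%:C.
Proof. by move=> hf; split=> //=; exact: rder_cst. Qed.

Lemma cderMl c f p : cder f p -> cder (fun t => c * f t) (c * p).
Proof.
move=> hf; have := cderM (cder_cst c) hf.
by apply: cder_eq => //; rewrite mul0r add0r.
Qed.

Definition qder (f : R -> H) (p : H) :=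
  cder (fun t => qre (f t)) (qre p) /\ cder (fun t => qim (f t)) (qim p).

Lemma qder_eq f g p q : f =1 g -> p = q -> qder f p -> qder g q.
Proof. by move=> /funext -> ->. Qed.

Lemma qder_cst c : qder (fun=> c) 0.
Proof. by split; exact: cder_cst. Qed.

Lemma qderD f g p q : qder f p -> qder g q -> qder (fun t => f t + g t) (p + q).
Proof. by move=> [f1 f2] [g1 g2]; split; exact: cderD. Qed.

Lemma qderM f g p q : qder f p -> qder g q ->
  qder (fun t => f t * g t) (p * g 0 + f 0 * q).
Proof.
move=> [f1 f2] [g1 g2]; split.
  have := cderD (cderM f1 g1) (cderN (cderM f2 (cderJ g2))).
  by apply: cder_eq => //; rewrite !(qreD, qreM); ring.
have := cderD (cderM f1 g2) (cderM f2 (cderJ g1)).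
by apply: cder_eq => //; rewrite !(qimD, qimM); ring.
Qed.

Lemma qder_uniq f p q : qder f p -> qder f q -> p = q.
Proof.
move=> [p1 p2] [q1 q2].
by apply: quatP; [exact: cder_uniq p1 q1|exact: cder_uniq p2 q2].
Qed.

Lemma qder_sum (I : Type) (r : seq I) (P : pred I)
    (f : I -> R -> H) (p : I -> H) :
  (forall i, qder (f i) (p i)) ->
  qder (fun t => \sum_(i <- r | P i) f i t) (\sum_(i <- r | P i) p i).
Proof.
move=> fp; elim: r => [|i r IH].
  by under eq_fun do rewrite big_nil; rewrite big_nil; exact: qder_cst.
under eq_fun do rewrite big_cons; rewrite big_cons.
by case: (P i) => //; exact: qderD.
Qed.

Lemma qderMl c f p : qder f p -> qder (fun t => c * f t) (c * p).
Proof.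
move=> hf; have := qderM (qder_cst c) hf.
by apply: qder_eq => //; rewrite mul0r add0r.
Qed.

Lemma qderMr c f p : qder f p -> qder (fun t => f t * c) (p * c).
Proof.
move=> hf; have := qderM hf (qder_cst c).
by apply: qder_eq => //; rewrite mulr0 addr0.
Qed.

Definition mxder m n (f : R -> 'M[H]_(m, n)) (p : 'M[H]_(m, n)) :=
  forall i j, qder (fun t => f t i j) (p i j).

Lemma mxder_mull m n l (A : 'M[H]_(l, m)) (f : R -> 'M[H]_(m, n)) p :
  mxder f p -> mxder (fun t => A *m f t) (A *m p).
Proof.
move=> fp i j; under eq_fun do rewrite mxE; rewrite mxE.
by apply: qder_sum => k; exact: qderMl.
Qed.

Lemma mxder_mulr m n l (A : 'M[H]_(n, l)) (f : R -> 'M[H]_(m, n)) p :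
  mxder f p -> mxder (fun t => f t *m A) (p *m A).
Proof.
move=> fp i j; under eq_fun do rewrite mxE; rewrite mxE.
by apply: qder_sum => k; exact: qderMr.
Qed.

Lemma mxder_uniq m n (f : R -> 'M[H]_(m, n)) p q :
  mxder f p -> mxder f q -> p = q.
Proof.
by move=> fp fq; apply/matrixP => i j; exact: qder_uniq (fp i j) (fq i j).
Qed.

Definition qnorm2 (x : H) : R :=
  Re (qre x) ^+ 2 + Im (qre x) ^+ 2 + Re (qim x) ^+ 2 + Im (qim x) ^+ 2.

Definition qinv (x : H) : H :=
  Quat ((qnorm2 x)^-1%:C * conjc (qre x)) (- ((qnorm2 x)^-1%:C * qim x)).

Lemma qnorm2_eq0 (x : H) : (qnorm2 x == 0) = (x == 0).
Proof.
apply/eqP/eqP => [|->]; last by rewrite /qnorm2 /= expr0n /= !addr0.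
case: x => [[a b] [c d]]; rewrite /qnorm2 /= => /eqP.
rewrite !paddr_eq0 ?addr_ge0 ?sqr_ge0 // !sqrf_eq0.
by move=> /andP [/andP [/andP [/eqP -> /eqP ->] /eqP ->] /eqP ->].
Qed.

Lemma qmulV (x : H) : x != 0 -> qinv x * x = 1 /\ x * qinv x = 1.
Proof.
rewrite -qnorm2_eq0; case: x => [[a b] [c d]] nx.
by split; apply: quatP; rewrite ?qreM ?qimM; apply/eqP; rewrite eq_complex /= ;
  apply/andP; split; apply/eqP; move: nx; rewrite /qnorm2 /= => nx; field.
Qed.

Lemma qinv_neq0 (x : H) : x != 0 -> qinv x != 0.
Proof.
move=> /qmulV [Vx _]; apply/eqP => x0; move: Vx; rewrite x0 mul0r => /eqP.
by rewrite eq_sym oner_eq0.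
Qed.

Lemma qinv1 : qinv 1 = 1.
Proof. by have [] := qmulV (oner_neq0 H); rewrite mulr1. Qed.

Lemma rder_qnorm2 f p : qder f p -> rder (fun t => qnorm2 (f t))
  (2 * (Re (qre p) * Re (qre (f 0)) + Im (qre p) * Im (qre (f 0)) +
        Re (qim p) * Re (qim (f 0)) + Im (qim p) * Im (qim (f 0)))).
Proof.
move=> [[f1 f2] [f3 f4]].
have := rderD (rderD (rderM f1 f1) (rderM f2 f2))
  (rderD (rderM f3 f3) (rderM f4 f4)).
by apply: rder_eq => [t|]; rewrite /qnorm2; ring.
Qed.

(** At the value 1 the noncommutative formula - f^-1 p f^-1 reduces to - p. It comes from conj(f) /
    |f|^2, with derivative conj(p) - 2 Re p. *)
Lemma qder_inv f p : f 0 = 1 -> qder f p -> qder (fun t => qinv (f t)) (- p).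
Proof.
move=> f0 hf; have hN : rder (fun t => qnorm2 (f t)) (2 * Re (qre p)).
  by have := rder_qnorm2 hf; congr rder; rewrite f0 /=; ring.
have [[f1 f2] [f3 f4]] := hf.
have N1 : qnorm2 (f 0) = 1 by rewrite f0 /qnorm2 /=; ring.
have hV : rder (fun t => (qnorm2 (f t))^-1) (- (2 * Re (qre p))).
  have := rderV _ hN; rewrite N1 expr1n divr1; apply; exact: oner_neq0.
split.
  have hre : cder (fun t => qre (f t)) (qre p) by [].
  have := cderM (cder_real hV) (cderJ hre).
  apply: cder_eq => //; rewrite N1 invr1 f0 /=; apply/eqP; rewrite eq_complex /=.
  by apply/andP; split; apply/eqP; rewrite !ReImE /=; ring.
have him : cder (fun t => qim (f t)) (qim p) by [].
have := cderN (cderM (cder_real hV) him).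
apply: cder_eq => //; rewrite N1 invr1 f0 /=; apply/eqP; rewrite eq_complex /=.
by apply/andP; split; apply/eqP; rewrite !ReImE /=; ring.
Qed.

End CurveDerivatives.

(** * The derivative of [rho] at the identity *)

Section RhoDerivative.
Variable R : realType.
Local Notation C := R[i].
Local Notation H := (quaternion R).
Local Notation P2 := (mpoly 2 C).
Local Notation X0 := (mpolyX C (mnm1 (0 : 'I_2))).
Local Notation X1 := (mpolyX C (mnm1 (1 : 'I_2))).
Local Notation comp2 p q := (comp_mpoly [tuple p; q]).
Local Notation qc := (@quat_of_complex R).

Definition pder (f : R -> P2) (p : P2) :=
  forall k, cder (fun t => mcoeff k (f t)) (mcoeff k p).

Lemma pder_eq f g p q : f =1 g -> p = q -> pder f p -> pder g q.
Proof. by move=> /funext -> ->. Qed.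

Lemma pder_cst P : pder (fun=> P) 0.
Proof. by move=> k; rewrite mcoeff0; exact: cder_cst. Qed.

Lemma pderD f g p q : pder f p -> pder g q -> pder (fun t => f t + g t) (p + q).
Proof.
move=> fp gq k; under eq_fun do rewrite mcoeffD; rewrite mcoeffD.
exact: cderD.
Qed.

Lemma pderM f g p q : pder f p -> pder g q ->
  pder (fun t => f t * g t) (p * g 0 + f 0 * q).
Proof.
(* The index set of the coefficient of a product depends on k alone, not on t, so this is a fixed
   finite sum. *)
move=> fp gq k; under eq_fun do rewrite mcoeffM.
rewrite mcoeffD !mcoeffM -big_split /=.
by apply: cder_sum => i; exact: cderM.
Qed.

Lemma pderZ (c : R -> C) c' (P : P2) :
  cder c c' -> pder (fun t => c t *: P) (c' *: P).
Proof.
move=> hc k; under eq_fun do rewrite mcoeffZ; rewrite mcoeffZ.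
have := cderM hc (cder_cst (mcoeff k P)).
by apply: cder_eq => //; rewrite mulr0 addr0.
Qed.

Lemma pderZl (c : C) f p : pder f p -> pder (fun t => c *: f t) (c *: p).
Proof.
move=> hf k; under eq_fun do rewrite mcoeffZ; rewrite mcoeffZ.
exact: cderMl.
Qed.

Lemma pderX f p k : pder f p -> pder (fun t => f t ^+ k) (f 0 ^+ k.-1 * p *+ k).
Proof.
move=> fp; elim: k => [|k IH]; first by rewrite mulr0n; exact: pder_cst.
have := pderM fp IH; apply: pder_eq => [t|]; first by rewrite exprS.
rewrite mulrnAr mulrA -exprS [k.+1.-1]/= mulrS [p * _]mulrC; congr (_ + _).
by case: k {IH} => [|k]; rewrite ?mulr0n.
Qed.

(* The derivative at t = 0 of the action of exp (t X) on z_0^k z_1^l, where X in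
   su(2) has first row (i x1, x2 + i x3) = (a, b). *)
Definition dact (a b : C) (k l : nat) : P2 :=
  (X0 ^+ k.-1 * (conjc a *: X0 + conjc b *: X1) *+ k) * X1 ^+ l
  + X0 ^+ k * (X1 ^+ l.-1 * (- b *: X0 + a *: X1) *+ l).

Definition dupos m (a b : C) (k : nat) : P2 :=
  (vnorm R (Vdeg m) k)^-1 *: dact a b k (Vdeg m - k).

Definition drho m (a b : C) : 'M[H]_m :=
  \matrix_(k < m) to_quat m (dupos m a b k).

Lemma dactD a b c d k l :
  dact (a + c) (b + d) k l = dact a b k l + dact c d k l.
Proof.
have e (S : comNzRingType) (p q x y u v : S) (p' q' : S) :
    (p * (x + y) *+ k) * q + p' * (q' * (u + v) *+ l) =
    (p * x *+ k) * q + p' * (q' * u *+ l) +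
    ((p * y *+ k) * q + p' * (q' * v *+ l)).
  by rewrite !mulrDr !mulrnDl mulrDl mulrDr addrACA.
rewrite /dact -e !conjcD opprD !scalerDl.
by rewrite (addrACA (conjc a *: X0)) (addrACA (- b *: X0)).
Qed.

(** The scalar has to be real, because a and b occur along with their conjugates: su(2) is a real
    Lie algebra. *)
Lemma dactZ (x : R) a b k l :
  dact (x%:C * a) (x%:C * b) k l = x%:C *: dact a b k l.
Proof.
have e (S : algType C) (c : C) (p q y u p' q' : S) :
    (p * (c *: y) *+ k) * q + p' * (q' * (c *: u) *+ l) =
    c *: ((p * y *+ k) * q + p' * (q' * u *+ l)).
  by rewrite -!scalerAr !scalerMnr -scalerAl -scalerAr scalerDr.
rewrite /dact !conjcM !conjc_real -mulrN -!scalerA.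
rewrite -(scalerDr x%:C (conjc a *: X0)) -(scalerDr x%:C (- b *: X0)).
exact: e.
Qed.

Lemma duposD m a b c d k :
  dupos m (a + c) (b + d) k = dupos m a b k + dupos m c d k.
Proof. by rewrite /dupos dactD; exact: scalerDr. Qed.

Lemma duposZ m (x : R) a b k :
  dupos m (x%:C * a) (x%:C * b) k = x%:C *: dupos m a b k.
Proof. by rewrite /dupos dactZ !scalerA mulrC. Qed.

Lemma row_drho m a b (k : 'I_m) :
  row k (drho m a b) = to_quat m (dupos m a b k).
Proof. exact: rowK. Qed.

Lemma drhoD m a b c d : drho m (a + c) (b + d) = drho m a b + drho m c d.
Proof.
apply/row_matrixP => k.
have -> : row k (drho m a b + drho m c d) =
    row k (drho m a b) + row k (drho m c d).
  exact: raddfD.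
apply: etrans (row_drho _ _ _) _; rewrite duposD to_quatD.
exact: congr2 (esym (row_drho _ _ _)) (esym (row_drho _ _ _)).
Qed.

Lemma drhoZ m (x : R) a b :
  drho m (x%:C * a) (x%:C * b) = qc x%:C *: drho m a b.
Proof.
apply/row_matrixP => k.
have -> : row k (qc x%:C *: drho m a b) = qc x%:C *: row k (drho m a b).
  by move: (drho m a b) => A; apply/rowP => i; rewrite !mxE.
apply: etrans (row_drho _ _ _) _; rewrite duposZ to_quatZ.
exact: congr1 (esym (row_drho _ _ _)).
Qed.

(** The torus substitutes e^(-it) z_0 and e^(it) z_1, so it multiplies z_0^k z_1^l by e^(i (l - k)
    t). *)
Lemma dact_diag k l :
  dact 'i%C 0 k l = ('i%C * (l%:R - k%:R)) *: mpolyX C (zexp k l).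
Proof.
have e (S : algType C) (x y : S) (c d : C) :
    (x ^+ k.-1 * (c *: x) *+ k) * y ^+ l +
    x ^+ k * (y ^+ l.-1 * (d *: y) *+ l) =
    (c * k%:R + d * l%:R) *: (x ^+ k * y ^+ l).
  have e1 (z : S) j b : z ^+ j.-1 * (b *: z) *+ j = (b * j%:R) *: z ^+ j.
    rewrite -scalerAr -exprSr mulr_natr -scalerMnl.
    by case: j => [|j]; rewrite ?mulr0n.
  by rewrite !e1 scalerDl scalerAl scalerAr.
rewrite /dact conjc0 oppr0 !scale0r addr0 add0r mpolyX2E.
have -> : 'i%C * (l%:R - k%:R) = conjc 'i%C * k%:R + 'i%C * l%:R :> C.
  by rewrite conjci; ring.
exact: e.
Qed.

Lemma drho_diag m (k l : 'I_m) :
  drho m 'i%C 0 k l = if k == l then qc ('i%C * (Vdeg m - 2 * k)%:R) else 0.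
Proof.
have -> : drho m 'i%C 0 k l = (row k (drho m 'i%C 0)) 0 l by rewrite [RHS]mxE.
rewrite row_drho /dupos dact_diag scalerA mulrC -scalerA -/(vpoly R _ _).
rewrite -/(upos R m k) to_quatZ to_quat_upos !mxE eqxx /= eq_sym.
case: eqP => [->|_]; last by rewrite mulr0.
rewrite mulr1; congr (qc (_ * _)); have kV : (2 * l <= Vdeg m)%N.
  by have := ltn_ord l; rewrite /Vdeg; lia.
rewrite -natrB; last by lia.
by congr (_%:R); lia.
Qed.

(** The entries are polynomial in a, b and their conjugates, so only the velocity at the identity
    matters; the curve need not be a one-parameter group. *)
Lemma mxder_rho m (a b : R -> C) a' b' :
  (forall t, a t * conjc (a t) + b t * conjc (b t) = 1) -> a 0 = 1 -> b 0 = 0 ->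
  cder a a' -> cder b b' ->
  mxder (fun t => rho m (su2 (a t) (b t))) (drho m a' b').
Proof.
move=> ab a0 b0 ha hb.
have hL0 := pderD (pderZ X0 (cderJ ha)) (pderZ X1 (cderJ hb)).
have hL1 := pderD (pderZ X0 (cderN hb)) (pderZ X1 ha).
have hP k l : pder (fun t => SU2act (su2 (a t) (b t)) (mpolyX C (zexp k l)))
    (dact a' b' k l).
  have := pderM (pderX k hL0) (pderX l hL1); apply: pder_eq => [t|].
    by rewrite su2_act // comp2X.
  by rewrite a0 b0 conjc0 conjc1 oppr0 !scale0r !scale1r addr0 add0r.
have hQ (k : 'I_m) : pder (fun t => SU2act (su2 (a t) (b t)) (upos R m k))
    (dupos m a' b' k).
  have := pderZl (vnorm R (Vdeg m) k)^-1 (hP k (Vdeg m - k)%N).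
  by apply: pder_eq => // t; rewrite /SU2act -linearZ.
move=> k l; rewrite /rho /drho.
under eq_fun do rewrite mxE mxE; rewrite mxE mxE.
split; first by apply: cderMl; exact: hQ.
apply: (cder_eq (f := fun t => ((-1) ^+ l * 'i%C)^-1 *
  vcoef (Vdeg m) (Vdeg m - l) (SU2act (su2 (a t) (b t)) (upos R m k))))
  => [t||].
- exact: mulrC.
- exact: mulrC.
by apply: cderMl; apply: cderMl; exact: hQ.
Qed.

End RhoDerivative.

(** * Direct sums *)

Section BlockDiagonal.
Variables (T : pzSemiRingType) (s : nat) (m : 'I_s -> nat) (N : nat).
Hypothesis hN : (\sum_(a < s) m a)%N = N.

Definition bdiag (B : forall a, 'M[T]_(m a)) : 'M[T]_N :=
  castmx (hN, hN) (\mxdiag_a B a).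

Definition bidx (r : 'I_N) : 'I_(\sum_(a < s) m a)%N := cast_ord (esym hN) r.

Lemma bidx_inj (r c : 'I_N) :
  tagnat.sig1 (bidx r) = tagnat.sig1 (bidx c) ->
  tagnat.sig2 (bidx r) = tagnat.sig2 (bidx c) :> nat -> r = c.
Proof.
move=> e1 e2; apply: (@cast_ord_inj _ _ (esym hN)).
apply: (can_inj tagnat.sigK).
move: e1 e2; rewrite -!/(bidx _) /tagnat.sig1 /tagnat.sig2.
case: (tagnat.sig (bidx r)) (tagnat.sig (bidx c)) => [i k] [j l] /= e.
by case: _ / e l => l e; congr existT; apply/val_inj.
Qed.

Lemma bdiag1 : bdiag (fun a => 1%:M) = 1%:M.
Proof. by rewrite /bdiag mxdiagZ; case: N / hN; rewrite castmx_id. Qed.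

Lemma bdiagM (A B : forall a, 'M[T]_(m a)) :
  bdiag A *m bdiag B = bdiag (fun a => A a *m B a).
Proof.
rewrite /bdiag; case: N / hN; rewrite !castmx_id [\mxdiag_a B a]/mxdiag.
rewrite mul_mxdiag_mxblock; apply/eq_mxblock => i j.
by case: eqP => [<-|_]; rewrite ?conform_mx_id ?mulmx0.
Qed.

Lemma eq_bdiag (A B : forall a, 'M[T]_(m a)) :
  (forall a, A a = B a) -> bdiag A = bdiag B.
Proof. by move=> AB; congr castmx; exact: eq_mxdiag. Qed.

Lemma bdiagD (A B : forall a, 'M[T]_(m a)) :
  bdiag A + bdiag B = bdiag (fun a => A a + B a).
Proof. by rewrite /bdiag mxdiagD; case: N / hN; rewrite !castmx_id. Qed.

Lemma bdiagZ c (A : forall a, 'M[T]_(m a)) :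
  c *: bdiag A = bdiag (fun a => c *: A a).
Proof.
rewrite -mul_scalar_mx.
have -> : c%:M = bdiag (fun a => c%:M).
  by rewrite /bdiag mxdiagZ; case: N / hN; rewrite castmx_id.
by rewrite bdiagM; apply: eq_bdiag => a; rewrite mul_scalar_mx.
Qed.

(** The alternative and the position in the block are independent of B, so a curve of block diagonal
    matrices can be differentiated entry by entry inside its blocks. *)
Lemma bdiag_entry r c :
  (forall B, bdiag B r c = 0) \/
  exists a k l, forall B : forall a, 'M[T]_(m a), bdiag B r c = B a k l.
Proof.
have [e|e] := eqVneq (tagnat.sig1 (bidx r)) (tagnat.sig1 (bidx c)); last first.
  by left=> B; rewrite castmxE mxE -/(bidx r) -/(bidx c) (negPf e) mxE.
right; suff [l hl] : exists l, forall B : forall a, 'M[T]_(m a),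
    bdiag B r c = B (tagnat.sig1 (bidx r)) (tagnat.sig2 (bidx r)) l.
  by do 2 eexists; exists l; exact: hl.
have h (B : forall a, 'M[T]_(m a)) : bdiag B r c =
    (conform_mx 0 (B (tagnat.sig1 (bidx r)))
       : 'M[T]_(_, m (tagnat.sig1 (bidx c))))
      (tagnat.sig2 (bidx r)) (tagnat.sig2 (bidx c)).
  by rewrite castmxE mxE -/(bidx r) -/(bidx c); case: eqP => // /(_ e).
(* With the positions generalised, the equality of the block indices can be eliminated, and
   [conform_mx] becomes the identity. *)
move: h; move: (tagnat.sig2 (bidx r)) (tagnat.sig2 (bidx c)).
case: _ / e => k l h.
by exists l => B; rewrite h conform_mx_id.
Qed.

Lemma bdiag_diag (B : forall a, 'M[T]_(m a)) (f : forall a, 'I_(m a) -> T) r c :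
  (forall a k l, B a k l = if k == l then f a k else 0) ->
  bdiag B r c = if r == c then f _ (tagnat.sig2 (bidx r)) else 0.
Proof.
move=> Bf; rewrite castmxE mxE -/(bidx r) -/(bidx c).
case: (r =P c) => [->|rc]; first by rewrite eqxx conform_mx_id Bf eqxx.
case: eqP => [e|_]; last by rewrite mxE.
have := @bidx_inj r c e.
move: (tagnat.sig2 (bidx r)) (tagnat.sig2 (bidx c)); case: _ / e => k l h.
by rewrite conform_mx_id Bf; case: eqP => // kl; case: rc; apply: h; rewrite kl.
Qed.

End BlockDiagonal.

(** * The representation [rho_sum] and its weights *)

Section RhoSum.
Variables (R : realType) (s : nat) (m : 'I_s -> nat) (N : nat).
Hypothesis m_ge1 : forall a, (1 <= m a)%N.
Hypothesis hN : (\sum_(a < s) m a)%N = N.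
Local Notation C := R[i].
Local Notation H := (quaternion R).
Local Notation qc := (@quat_of_complex R).
Local Notation rhoS := (@rho_sum R s m N hN).

Lemma rho_sumE g : rhoS g = bdiag hN (fun a => @rho R (m a) g).
Proof. by []. Qed.

Lemma rho_sum1 : rhoS 1%:M = 1%:M.
Proof.
rewrite rho_sumE -[RHS](bdiag1 _ hN); apply: eq_bdiag => a; exact: rho1.
Qed.

Lemma rho_sumM (g h : 'M[C]_2) : SU2 g -> SU2 h ->
  rhoS (g *m h) = rhoS g *m rhoS h.
Proof.
by move=> gS hS; rewrite !rho_sumE bdiagM; apply: eq_bdiag => a; exact: rhoM.
Qed.

Definition drho_sum (a b : C) : 'M[H]_N := bdiag hN (fun i => drho (m i) a b).

Lemma drho_sumD a b c d :
  drho_sum (a + c) (b + d) = drho_sum a b + drho_sum c d.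
Proof. by rewrite /drho_sum bdiagD; apply: eq_bdiag => i; exact: drhoD. Qed.

Lemma drho_sumZ (x : R) a b :
  drho_sum (x%:C * a) (x%:C * b) = qc x%:C *: drho_sum a b.
Proof. by rewrite /drho_sum bdiagZ; apply: eq_bdiag => i; exact: drhoZ. Qed.

(** The r-th coordinate a + b j carries both weights: a belongs to u_lambda and b to u_{-lambda},
    with lambda the positive one. The subtraction does not truncate, since the position k in a block
    of size m satisfies 2k <= 2m - 2. *)
Definition weight (r : 'I_N) : nat :=
  (Vdeg (m (tagnat.sig1 (bidx hN r))) - 2 * tagnat.sig2 (bidx hN r))%N.

Lemma drho_sum_diag (r c : 'I_N) :
  drho_sum 'i%C 0 r c = if r == c then qc ('i%C * (weight r)%:R) else 0.
Proof.
apply: (@bdiag_diag H s m N hN _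
  (fun a (k : 'I_(m a)) => qc ('i%C * (Vdeg (m a) - 2 * k)%:R)) r c) => a k l.
exact: drho_diag.
Qed.

Lemma mxder_rho_sum (a b : R -> C) a' b' :
  (forall t, a t * conjc (a t) + b t * conjc (b t) = 1) -> a 0 = 1 -> b 0 = 0 ->
  cder a a' -> cder b b' ->
  mxder (fun t => rhoS (su2 (a t) (b t))) (drho_sum a' b').
Proof.
move=> ab a0 b0 ha hb r c.
have [h|[i [k [l h]]]] := bdiag_entry H hN r c.
  rewrite /drho_sum h; apply: (qder_eq (f := fun=> 0)) (qder_cst 0) => // t.
  by rewrite rho_sumE h.
rewrite /drho_sum h.
apply: (qder_eq (f := fun t => @rho R (m i) (su2 (a t) (b t)) k l))
  => // [t|].
  by rewrite rho_sumE h.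
exact: (@mxder_rho R (m i) a b a' b' ab a0 b0 ha hb k l).
Qed.

Lemma weight_odd r : odd (weight r).
Proof.
have := ltn_ord (tagnat.sig2 (bidx hN r)).
have := m_ge1 (tagnat.sig1 (bidx hN r)).
rewrite /weight /Vdeg => m1 km; rewrite !oddB ?oddM //; lia.
Qed.

(** For odd lambda the halving in [uvec] is exact and yields the only index of weight lambda. Beyond
    2k - 1 there is no such index, in agreement with the default value 0. *)
Lemma uvec_entry (k : nat) (lambda : nat) (i : 'I_k) : odd lambda ->
  uvec R k lambda 0 i = ((Vdeg k - 2 * i)%N == lambda)%:R.
Proof.
move=> lo; have ik := ltn_ord i; rewrite /uvec; case: leqP => [lV|Vl]; last first.
  by rewrite mxE; case: eqP => // e; move: Vl; rewrite -e; lia.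
have ok : ((Vdeg k - lambda)./2 < k)%N by move: lV lo; rewrite /Vdeg; lia.
rewrite -[((Vdeg k - lambda)./2)%N]/(nat_of_ord (Ordinal ok)).
rewrite to_quat_upos !mxE eqxx /=.
congr (nat_of_bool _)%:R; rewrite -val_eqE /=; apply/eqP/eqP => [->|<-].
  by move: lV lo; rewrite /Vdeg; lia.
by move: lV lo; rewrite /Vdeg; lia.
Qed.

Lemma uvec_sum_entry (lambda : nat) (a : 'I_s) (r : 'I_N) : odd lambda ->
  uvec_sum R hN lambda a 0 r =
  ((tagnat.sig1 (bidx hN r) == a) && (weight r == lambda))%:R.
Proof.
move=> lo; rewrite castmxE mxE cast_ord_id -/(bidx hN r).
by case: eqP => _; [exact: uvec_entry|rewrite mxE].
Qed.

(* As w_r = 1 the eigenvalue q is i lambda_r, and (a + b j) i = i (a - b j)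
   forces the nonzero entries of w to be complex and of weight lambda_r. *)
Lemma torus_eigenvector (w : 'rV[H]_N) (q : H) (r : 'I_N) :
  w 0 r = 1 -> w *m drho_sum 'i%C 0 = q *: w ->
  exists c : 'I_s -> C,
    w = \sum_(a < s) qc (c a) *: uvec_sum R hN (weight r) a.
Proof.
move=> wr1 wq.
have e k : w 0 k * qc ('i%C * (weight k)%:R) = q * w 0 k.
  have := congr1 (fun v : 'rV[H]_N => v 0 k) wq.
  rewrite !mxE (bigD1 k) //= big1.
    by rewrite drho_sum_diag eqxx addr0.
  by move=> j /negPf jk; rewrite drho_sum_diag jk mulr0.
have qE : q = qc ('i%C * (weight r)%:R) by have := e r; rewrite wr1 mul1r mulr1.
have i0 : 'i%C != 0 :> C by apply/eqP => -[] /eqP; rewrite oner_eq0.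
have wt k : qim (w 0 k) = 0 /\ (weight k != weight r -> qre (w 0 k) = 0).
  have := e k; rewrite qE; case: (w 0 k) => a b /= ek; split.
    have := congr1 (@qim R) ek; rewrite !qimM /= conjcM conjc_nat conjci.
    rewrite mulr0 mul0r addr0 add0r => /eqP; rewrite -subr_eq0.
    (* Moving i past j changes its sign, so the two weights add up; an odd weight is not 0, hence b
       = 0. *)
    have -> : b * (- 'i%C * (weight k)%:R) - 'i%C * (weight r)%:R * b =
        - (b * ('i%C * (weight k + weight r)%:R)) by rewrite natrD; ring.
    rewrite oppr_eq0 mulf_eq0 => /orP [/eqP //|].
    rewrite mulf_eq0 (negPf i0) pnatr_eq0 addn_eq0 => /andP [/eqP k0].
    by have := weight_odd k; rewrite k0.
  have := congr1 (@qre R) ek; rewrite !qreM [qim (qc _)]/(0 : C) conjc0 /=.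
  move/eqP; rewrite mulr0 mul0r !subr0 mulrC -subr_eq0 -mulrBl -mulrBr.
  rewrite !mulf_eq0 (negPf i0) /= subr_eq0 eqr_nat.
  by move=> /orP [->|/eqP].
(* The weights within one block are distinct, so this sum has at most one term: it is the coordinate
   of weight lambda_r in block a, or 0 if there is none. *)
exists (fun a => \sum_(k | (tagnat.sig1 (bidx hN k) == a) &&
  (weight k == weight r)) qre (w 0 k)).
apply/rowP => k; rewrite summxE.
under eq_bigr do rewrite mxE uvec_sum_entry ?weight_odd //.
rewrite (bigD1 (tagnat.sig1 (bidx hN k))) //= eqxx.
rewrite [X in _ + X]big1 => [|a /negPf ak]; last first.
  by rewrite eq_sym ak mulr0.
rewrite addr0 andTb; have [ib wre] := wt k.
case: eqP => [kr|/eqP kr]; last first.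
  by rewrite mulr0; apply: quatP; [exact: wre|exact: ib].
rewrite mulr1 (bigD1 k) ?eqxx ?kr ?eqxx //=.
rewrite big1 => [|j /andP [/andP [/eqP ja /eqP jr] jk]].
  by apply: quatP; rewrite //= addr0.
case/eqP: jk; apply: (bidx_inj ja); move: jr; rewrite -kr /weight.
have := ltn_ord (tagnat.sig2 (bidx hN j)).
have := ltn_ord (tagnat.sig2 (bidx hN k)).
by have := congr1 m ja; rewrite /Vdeg; lia.
Qed.

End RhoSum.

(** * Tangent vectors of submanifolds *)

Section Tangent.
Variable R : realType.

Lemma mx_entry_le_norm p q (y : 'M[R]_(p, q)) i j : `|y i j| <= `|y|.
Proof.
rewrite [leRHS]/Num.Def.normr /= mx_normrE.
by apply: le_trans (le_bigmax _ _ (i, j)).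
Qed.

Lemma linear_mx_bounded p q (W : normedModType R)
    (f : {linear 'M[R]_(p, q) -> W}) :
  exists2 K, 0 < K & forall y, `|f y| <= K * `|y|.
Proof.
pose K := \sum_i \sum_j `|f (delta_mx i j)|; exists (1 + K).
  by rewrite ltr_pwDl // sumr_ge0 // => i _; rewrite sumr_ge0.
move=> y; rewrite mulrDl mul1r (@le_trans _ _ (K * `|y|)) ?lerDr //.
rewrite {1}[y]matrix_sum_delta linear_sum (le_trans (ler_norm_sum _ _ _)) //.
rewrite mulr_suml; apply: ler_sum => i _.
rewrite linear_sum (le_trans (ler_norm_sum _ _ _)) // mulr_suml.
apply: ler_sum => j _; rewrite linearZ normrZ mulrC ler_wpM2l //.
exact: mx_entry_le_norm.
Qed.

Lemma linear_mx_left_inverse d p q (f : {linear 'rV[R]_d -> 'M[R]_(p, q)}) :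
  injective f -> exists g : {linear 'M[R]_(p, q) -> 'rV[R]_d}, cancel f g.
Proof.
move=> finj.
pose B := lin1_mx (mxvec \o f).
have BE u : u *m B = mxvec (f u) by rewrite mul_rV_lin1.
have Bfree : row_free B.
  apply: inj_row_free => u; rewrite BE => /eqP; rewrite mxvec_eq0 => /eqP fu.
  by apply: finj; rewrite fu linear0.
exists (mulmxr (pinvmx B) \o mxvec) => u /=.
by rewrite -BE -mulmxA mulmxVp // mulmx1.
Qed.

(* psi o gamma need only be continuous: as phi is differentiable with a
   left-invertible differential at psi x, |psi (gamma t) - psi x| is bounded by a
   multiple of |gamma t - x|, so that gamma' (0) lies in the image of 'd phi. *)
Lemma submanifold_tangent d p q (S : set 'M[R]_(p, q)) x :
  submanifold d S -> S x ->
  exists L : {linear 'rV[R]_d -> 'M[R]_(p, q)},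
    forall (gamma : R -> 'M[R]_(p, q)) v,
    gamma 0 = x -> (\forall t \near (0 : R), S (gamma t)) ->
    is_derive (0 : R) (1 : R) gamma v -> exists u, v = L u.
Proof.
move=> Sd Sx.
have [U [A [phi [psi [Uo [Ao Ax] Usm dinj [imU psiK psic]]]]]] := Sd x Sx.
have [u0 Uu0 phiu0] : (phi @` U) x by rewrite imU.
have dphi : differentiable phi u0 by have [/(_ u0 Uu0)] := Usm 1%N.
exists ('d phi u0) => gamma v g0 gS [gder gv].
have [G GK] := linear_mx_left_inverse (dinj u0 Uu0).
exists (G v).
(* [Pj] is a projection that vanishes exactly on the image of ['d phi u0]; the goal amounts to
   [Pj v = 0]. *)
pose Pj := idfun \- ('d phi u0 \o G).
have PjE y : Pj y = y - 'd phi u0 (G y) by [].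
have [K K0 GB] := linear_mx_bounded G.
have [K2 K20 PB] := linear_mx_bounded Pj.
have gc : gamma t @[t --> (0:R)] --> x.
  by rewrite -g0; apply/differentiable_continuous/derivable1_diffP.
have gA : \forall t \near (0 : R), A (gamma t).
  by apply: gc; exact: open_nbhs_nbhs.
have psix : psi x = u0 by rewrite -phiu0 psiK // inE.
have dc : psi (gamma t) @[t --> (0 : R)] --> u0.
  rewrite -psix.
  (* [psi] is continuous only relative to the trace of S on A, which gamma does not leave near 0. *)
  apply: cvg_comp (_ : gamma @ (0 : R) --> within (S `&` A) (nbhs x)) _.
    move=> P /gc nP; apply: filterS3 gS gA nP => t St At; exact.
  by move/subspace_continuousP : psic; apply.
have gphi : \forall t \near (0 : R), gamma t = phi (psi (gamma t)).
  near=> t.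
  have : (S `&` A) (gamma t) by split; near: t.
  by rewrite -imU => -[u Uu <-]; rewrite psiK // inE.
have eps_bound e : 0 < e -> \forall h \near (0 : 'rV[R]_d),
    `|phi (h + u0) - (phi u0 + 'd phi u0 h)| <= e * `|h|.
  by move=> e0; have /diff_locally/eqaddoP/(_ e e0) := dphi.
have key e : 0 < e -> e <= 1 -> e * K <= 2^-1 ->
    `|Pj v| <= e * (K2 * (K * 2 * (`|v| + 1)) + K2).
  move=> e0 e1 eK.
  have hc : (psi (gamma t) - u0) @[t --> (0 : R)] --> (0 : 'rV[R]_d).
    by rewrite -(subrr u0); apply: cvgB dc (cvg_cst _).
  have sc : (t^-1 *: (gamma t - x)) @[t --> (0 : R)^'] --> v.
    rewrite -gv -g0; have := gder; rewrite /derivable /derive.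
    have -> : (fun h : R => h^-1 *: ((gamma \o shift 0) (h *: 1) - gamma 0)) =
        (fun h : R => h^-1 *: (gamma h - gamma 0)).
      by apply/funext => h /=; rewrite addr0 /GRing.scale /= mulr1.
    exact.
  have sd : \forall t \near (0 : R)^', `|v - t^-1 *: (gamma t - x)| <= e.
    exact: (cvgrPdist_le _ _).1 sc _ e0.
  have hd : \forall t \near (0 : R), `|phi (psi (gamma t) - u0 + u0) -
      (phi u0 + 'd phi u0 (psi (gamma t) - u0))| <= e * `|psi (gamma t) - u0|.
    exact: hc _ (eps_bound e e0).
  have [t [/= ds [/= dh gt]]] :=
    filter_ex (filterI sd (nbhs_dnbhs (filterI hd gphi))).
  rewrite subrK -gt phiu0 in dh.
  move: (psi (gamma t) - u0) dh => h dh.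
  have hb : `|h| <= K * 2 * `|gamma t - x|.
    (* The unknown [|h|] occurs on both sides; as [e * K <= 2^-1], the right-hand occurrence is
       absorbed. *)
    have h1 : `|h| <= K * (`|gamma t - x| + e * `|h|).
      rewrite -{1}(GK h); apply: (le_trans (GB _)); rewrite ler_pM2l //.
      have -> : 'd phi u0 h = (gamma t - x) - (gamma t - (x + 'd phi u0 h)).
        by rewrite opprB addrA [_ + (x + _)]addrA subrK addrAC subrr add0r.
      by apply: (le_trans (ler_normB _ _)); rewrite lerD2l.
    have h2 : e * K * `|h| <= 2^-1 * `|h| by rewrite ler_wpM2r.
    nra.
  have Pb : `|Pj (gamma t - x)| <= K2 * (e * (K * 2 * `|gamma t - x|)).
    (* [Pj] kills ['d phi u0 h], so only the first-order remainder, of size e |h|, is left. *)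
    have -> : Pj (gamma t - x) = Pj (gamma t - (x + 'd phi u0 h)).
      rewrite opprD addrA !PjE.
      have GBB a b : G (a - b) = G a - G b by exact: linearB.
      have DBB a b : 'd phi u0 (a - b) = 'd phi u0 a - 'd phi u0 b.
        exact: linearB.
      by rewrite (GBB (gamma t - x)) GK DBB opprB addrA subrK.
    apply: (le_trans (PB _)); rewrite ler_pM2l // (le_trans dh) // ler_pM2l //.
  have Ps : `|Pj (t^-1 *: (gamma t - x))| <=
      K2 * (e * (K * 2 * `|t^-1 *: (gamma t - x)|)).
    have -> : Pj (t^-1 *: (gamma t - x)) = t^-1 *: Pj (gamma t - x).
      exact: linearZ.
    rewrite !normrZ.
    have := ler_wpM2l (normr_ge0 t^-1) Pb; congr (_ <= _); ring.
  have sb : `|t^-1 *: (gamma t - x)| <= `|v| + 1.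
    rewrite -[_ *: _](subKr v) (le_trans (ler_normB _ _)) // lerD2l.
    exact: le_trans ds e1.
  have -> : Pj v = Pj (v - t^-1 *: (gamma t - x)) + Pj (t^-1 *: (gamma t - x)).
    by rewrite -[in LHS](subrK (t^-1 *: (gamma t - x)) v); exact: linearD.
  apply: (le_trans (ler_normD _ _)).
  have := PB (v - t^-1 *: (gamma t - x)).
  have : K2 * `|v - t^-1 *: (gamma t - x)| <= K2 * e by rewrite ler_pM2l.
  have : K2 * (e * (K * 2 * `|t^-1 *: (gamma t - x)|)) <=
      K2 * (e * (K * 2 * (`|v| + 1))).
    by rewrite !ler_pM2l // mulr_gt0.
  lra.
set c := K2 * (K * 2 * (`|v| + 1)) + K2 in key.
have c0 : 0 < c by rewrite /c addr_gt0 // !mulr_gt0 // ltr_wpDl.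
suff /eqP : `|Pj v| = 0 by rewrite normr_eq0 /Pj /= subr_eq0 => /eqP.
apply/eqP; rewrite eq_le normr_ge0 andbT leNgt; apply/negP => a0.
(* The first two bounds are the hypotheses of [key]; the third makes its conclusion
   [|Pj v| <= |Pj v| / 2], which is absurd. *)
pose e := Num.min 1 (Num.min (2^-1 / K) (`|Pj v| / c / 2)).
have e0 : 0 < e by rewrite /e !lt_min ltr01 !divr_gt0.
have e1 : e <= 1 by rewrite /e ge_min lexx.
have eK : e * K <= 2^-1 by rewrite -ler_pdivlMr // /e !ge_min lexx !orbT.
have ec : e * c <= `|Pj v| / 2.
  rewrite -ler_pdivlMr // mulrAC; by rewrite /e !ge_min lexx !orbT.
have := key e e0 e1 eK; rewrite -/c; lra.
Unshelve. all: by end_near.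
Qed.

End Tangent.

(** * Orbits *)

Section Circles.
Variable R : realType.
Local Notation C := R[i].
Local Notation H := (quaternion R).
Local Notation qc := (@quat_of_complex R).

(* [su2 (circle_a x1 t) (circle_b x2 x3 t)] is exp (t X) for X in su(2) with
   first row (i x1, x2 + i x3) of norm 1. *)
Definition circle_a (x1 t : R) : C := cos t +i* (x1 * sin t).
Definition circle_b (x2 x3 t : R) : C := (x2 * sin t) +i* (x3 * sin t).

Lemma circle_norm x1 x2 x3 t : x1 ^+ 2 + x2 ^+ 2 + x3 ^+ 2 = 1 ->
  circle_a x1 t * conjc (circle_a x1 t) +
  circle_b x2 x3 t * conjc (circle_b x2 x3 t) = 1.
Proof.
move=> x; apply/eqP; rewrite eq_complex /=.
apply/andP; split; apply/eqP; last by ring.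
transitivity (cos t ^+ 2 + (x1 ^+ 2 + x2 ^+ 2 + x3 ^+ 2) * sin t ^+ 2).
  by ring.
by rewrite x mul1r cos2Dsin2.
Qed.

Lemma circle_a0 x1 : circle_a x1 0 = 1.
Proof. by rewrite /circle_a cos0 sin0 mulr0. Qed.

Lemma circle_b0 x2 x3 : circle_b x2 x3 0 = 0.
Proof. by rewrite /circle_b sin0 !mulr0. Qed.

Lemma rder_sinM (c : R) : rder (fun t => c * sin t) c.
Proof.
have := rderM (rder_cst c) (is_derive_sin (0 : R) : rder _ _).
by congr rder; rewrite cos0 mul0r add0r mulr1.
Qed.

Lemma cder_circle_a x1 : cder (circle_a x1) (0 +i* x1).
Proof.
split => /=; last exact: rder_sinM.
have := is_derive_cos (0 : R); rewrite sin0 oppr0; exact.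
Qed.

Lemma cder_circle_b x2 x3 : cder (circle_b x2 x3) (x2 +i* x3).
Proof. by split; exact: rder_sinM. Qed.

(* The columns of h are unit eigenvectors of X for i and - i; they are computed
   from (i (1 + x1), - x2 + i x3), which vanishes when x1 = - 1. *)
Lemma circle_conj x1 x2 x3 : x1 ^+ 2 + x2 ^+ 2 + x3 ^+ 2 = 1 ->
  exists2 h : 'M[C]_2, SU2 h & forall t,
    su2 (circle_a x1 t) (circle_b x2 x3 t) *m h =
    h *m su2 (circle_a 1 t) (circle_b 0 0 t).
Proof.
move=> x; have [x1N|x1N] := eqVneq x1 (-1).
  have [x20 x30] : x2 = 0 /\ x3 = 0.
    have /eqP : x2 ^+ 2 + x3 ^+ 2 = 0 by move: x; rewrite x1N; lra.
    rewrite paddr_eq0 ?sqr_ge0 // !sqrf_eq0.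
    by move=> /andP [/eqP -> /eqP ->].
  (* Here X = diag (- i, i), and the Weyl element exchanges the two eigenlines. *)
  exists (su2 0 1).
    by apply/SU2P; exists 0, 1; rewrite conjc1 mul0r mul1r add0r.
  move=> t; rewrite !su2M; congr su2; apply/eqP;
  rewrite eq_complex /= x1N ?x20 ?x30;
  by apply/andP; split; apply/eqP; ring.
have x1P : 0 < 1 + x1.
  rewrite lt_neqAle eq_sym addrC addr_eq0 x1N /=.
  have := sqr_ge0 x2; have := sqr_ge0 x3; nra.
(* The eigenvector has squared norm (1 + x1)^2 + x2^2 + x3^2 = 2 (1 + x1). *)
pose s := (Num.sqrt (2 * (1 + x1)))^-1.
have s2 : s ^+ 2 * (2 * (1 + x1)) = 1.
  rewrite /s exprVn sqr_sqrtr ?mulVf //; first by rewrite gt_eqF // mulr_gt0.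
  by rewrite ltW // mulr_gt0.
have b2 : x2 ^+ 2 + x3 ^+ 2 = (1 - x1) * (1 + x1) by move: x; lra.
exists (su2 (0 +i* (s * (1 + x1))) ((s * x2) +i* (s * x3))).
  apply/SU2P; do 2 eexists; split; last reflexivity.
  apply/eqP; rewrite eq_complex /=; apply/andP; split; apply/eqP; last by ring.
  transitivity (s ^+ 2 * ((1 + x1) ^+ 2 + (x2 ^+ 2 + x3 ^+ 2))); first by ring.
  by rewrite b2 -[RHS]s2; ring.
move=> t; rewrite !su2M; congr su2; apply/eqP; rewrite eq_complex /=;
  apply/andP; split; apply/eqP.
- transitivity (- s * sin t * (x1 * (1 + x1) + (x2 ^+ 2 + x3 ^+ 2))).
    by ring.
  by rewrite b2; ring.
- by ring.
- by ring.
- by ring.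
Qed.
End Circles.

(** * Quaternionic lines in affine charts *)

Section Charts.
Variable R : realType.
Local Notation C := R[i].
Local Notation H := (quaternion R).
Local Notation qc := (@quat_of_complex R).

Lemma qc_real_comm (x : R) (y : H) : qc x%:C * y = y * qc x%:C.
Proof.
apply: quatP;
  rewrite ?qreM ?qimM [qim (qc _)]/(0 : C) [qre (qc _)]/(x%:C) ?conjc0.
  by rewrite !(mul0r, mulr0) mulrC.
by rewrite conjc_real !(mul0r, mulr0) mulrC addr0 add0r.
Qed.

(** A left scalar passes a quaternionic matrix when it is central, as real numbers are. *)
Lemma scalemxAr_real (x : R) p q r (A : 'M[H]_(p, q)) (B : 'M[H]_(q, r)) :
  qc x%:C *: (A *m B) = A *m (qc x%:C *: B).
Proof.
apply/matrixP => i j; rewrite !mxE mulr_sumr; apply: eq_bigr => k _.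
by rewrite !mxE !mulrA qc_real_comm.
Qed.

Lemma hline_scale N (q : H) (z : 'rV[H]_N) : q != 0 -> hline (q *: z) = hline z.
Proof.
move=> /qmulV [Vq _].
apply/seteqP; split=> _ [p _ <-].
  by exists (p * q) => //; rewrite scalerA.
by exists (p * qinv q) => //; rewrite scalerA -mulrA Vq mulr1.
Qed.

Lemma hline_mulmx N (A : 'M[H]_N) (z : 'rV[H]_N) :
  [set w *m A | w in hline z] = hline (z *m A).
Proof.
apply/seteqP; split=> [_ [_ [p _ <-] <-]|_ [p _ <-]].
  by exists p => //; rewrite scalemxAl.
by exists (p *: z); [exists p|rewrite scalemxAl].
Qed.

Definition qcoord (l : 'I_4) (x : H) : R :=
  nth 0 [:: complex.Re (qre x); complex.Im (qre x);
            complex.Re (qim x); complex.Im (qim x)] l.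

Lemma qcoordD l x y : qcoord l (x + y) = qcoord l x + qcoord l y.
Proof.
by case: x y => [[? ?] [? ?]] [[? ?] [? ?]]; case: l => -[|[|[|[|]]]].
Qed.

Lemma qcoordZ l (c : R) x : qcoord l (qc c%:C * x) = c * qcoord l x.
Proof.
case: x => [[? ?] [? ?]]; case: l => -[|[|[|[|//]]]] p; rewrite /qcoord /=; ring.
Qed.

Lemma qcoord_inj x y : (forall l, qcoord l x = qcoord l y) -> x = y.
Proof.
case: x y => [[a b] [c d]] [[a' b'] [c' d']] e.
by have := (e (Ordinal (isT : 0 < 4)%N), e (Ordinal (isT : 1 < 4)%N),
  e (Ordinal (isT : 2 < 4)%N), e (Ordinal (isT : 3 < 4)%N));
  rewrite /qcoord /= => -[[[-> ->] ->] ->].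
Qed.

Lemma rder_qcoord l f p :
  qder f p -> rder (fun t => qcoord l (f t)) (qcoord l p).
Proof. by move=> [[? ?] [? ?]]; case: l => -[|[|[|[|]]]]. Qed.

Definition chart n (i : 'I_n.+1) (w : 'rV[H]_n.+1) : 'M[R]_(n, 4) :=
  \matrix_(k < n, l < 4) qcoord l (w 0 (lift i k)).

Lemma chartD n (i : 'I_n.+1) v w : chart i (v + w) = chart i v + chart i w.
Proof. by apply/matrixP => k l; rewrite !mxE qcoordD. Qed.

Lemma chartZ n (i : 'I_n.+1) (c : R) w :
  chart i (qc c%:C *: w) = c *: chart i w.
Proof. by apply/matrixP => k l; rewrite !mxE qcoordZ. Qed.

Lemma chartK n (i : 'I_n.+1) (w : 'rV[H]_n.+1) :
  w 0 i = 1 -> affine_point i (chart i w) = w.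
Proof.
move=> wi; apply/rowP => j; rewrite mxE.
case: unliftP => [k ->|-> //].
rewrite /quat_of_reals !mxE /qcoord /=.
by case: (w 0 (lift i k)) => [[a b] [c d]].
Qed.

Lemma chart_inj n (i : 'I_n.+1) (v w : 'rV[H]_n.+1) :
  v 0 i = w 0 i -> chart i v = chart i w -> v = w.
Proof.
move=> vwi e; apply/rowP => j; case: (unliftP i j) => [k ->|-> //].
apply: qcoord_inj => l.
by have := congr1 (fun A : 'M[R]_(n, 4) => A k l) e; rewrite !mxE.
Qed.

Lemma is_derive_chart n (i : 'I_n.+1) (w : R -> 'rV[H]_n.+1)
    (w' : 'rV[H]_n.+1) :
  mxder w w' ->
  is_derive (0 : R) (1 : R) (fun t => chart i (w t) : 'M[R]_(n.+1.-1, 4))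
    (chart i w').
Proof.
move=> h; have hkl (k : 'I_n) (l : 'I_4) :
    rder (fun t => chart i (w t) k l) (chart i w' k l).
  under eq_fun do rewrite mxE; rewrite mxE; apply: rder_qcoord; exact: h.
have der : derivable (fun t => chart i (w t) : 'M[R]_(n.+1.-1, 4)) (0 : R) 1.
  by apply/derivable_mxP => k l; have [] := hkl k l.
split=> //; rewrite derive_mx //.
by apply/matrixP => k l; rewrite mxE; have [_] := hkl k l.
Qed.

(** The subtracted term is the derivative of the normalising factor. The curve of lines is sure to
    stay in the i-th chart only for t near 0. *)
Lemma normalized_curve n (i : 'I_n.+1) (w : R -> 'rV[H]_n.+1)
    (w' : 'rV[H]_n.+1) :
  w 0 0 i = 1 -> mxder w w' ->
  (\forall t \near (0 : R), w t 0 i != 0) /\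
  mxder (fun t => qinv (w t 0 i) *: w t) (w' - w' 0 i *: w 0).
Proof.
move=> w0 hw; have hi := qder_inv (w0 : (fun t => w t 0 i) 0 = 1) (hw 0 i).
split.
  have := cvgr_neq0 _ (rder_continuous (rder_qnorm2 (hw 0 i))); rewrite w0.
  have n1 : qnorm2 (1 : H) != 0 by rewrite qnorm2_eq0 oner_neq0.
  move=> /(_ _ n1); apply: filterS => t; by rewrite qnorm2_eq0.
move=> k j; rewrite (ord1 k).
have := qderM hi (hw 0 j); apply: qder_eq => [t|]; first by rewrite mxE.
by rewrite !mxE w0 qinv1 mul1r addrC mulNr.
Qed.

End Charts.

(** * Infinitesimal stabilisers and weight vectors in an orbit *)

Section Orbits.
Variables (R : realType) (n s : nat) (m : 'I_s -> nat).
Hypothesis m_ge1 : forall a, (1 <= m a)%N.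
Hypothesis hN : (\sum_(a < s) m a)%N = n.+1.
Local Notation C := R[i].
Local Notation H := (quaternion R).
Local Notation qc := (@quat_of_complex R).
Local Notation rhoS := (@rho_sum R s m n.+1 hN).
Local Notation drhoS := (@drho_sum R s m n.+1 hN).

Lemma SU2_circle x1 x2 x3 t : x1 ^+ 2 + x2 ^+ 2 + x3 ^+ 2 = 1 :> R ->
  SU2 (su2 (circle_a x1 t) (circle_b x2 x3 t)).
Proof.
by move=> x; apply/SU2P; do 2 eexists; split; first exact: circle_norm x.
Qed.

Lemma mxder_circle x1 x2 x3 : x1 ^+ 2 + x2 ^+ 2 + x3 ^+ 2 = 1 :> R ->
  mxder (fun t => rhoS (su2 (circle_a x1 t) (circle_b x2 x3 t)))
    (drhoS (0 +i* x1) (x2 +i* x3)).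
Proof.
move=> x; apply: mxder_rho_sum.
- by move=> t; exact: circle_norm.
- exact: circle_a0.
- exact: circle_b0.
- exact: cder_circle_a.
- exact: cder_circle_b.
Qed.

(** For z_i = 1 this is the velocity of the orbit modulo the line H z: it vanishes exactly when X
    fixes [z] infinitesimally. *)
Definition orbit_tangent (i : 'I_n.+1) (z : 'rV[H]_n.+1) (x1 x2 x3 : R) :=
  let v := z *m drhoS (0 +i* x1) (x2 +i* x3) in v - v 0 i *: z.

Lemma circle_chart_curve (i : 'I_n.+1) (z : 'rV[H]_n.+1) x1 x2 x3 :
  z 0 i = 1 -> x1 ^+ 2 + x2 ^+ 2 + x3 ^+ 2 = 1 ->
  exists gamma : R -> 'M[R]_(n.+1.-1, 4), [/\ gamma 0 = chart i z,
    \forall t \near (0 : R), exists2 g, SU2 g &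
      hline (affine_point i (gamma t)) = hline (z *m rhoS g) &
    is_derive (0 : R) (1 : R) gamma (chart i (orbit_tangent i z x1 x2 x3))].
Proof.
move=> zi x; pose g t := su2 (circle_a x1 t) (circle_b x2 x3 t).
pose w t := z *m rhoS (g t).
have w0 : w 0 = z by rewrite /w /g circle_a0 circle_b0 su2_1 rho_sum1 mulmx1.
have wi : w 0 0 i = 1 by rewrite w0.
have [wn0 dw] := normalized_curve wi (mxder_mull z (mxder_circle x)).
exists (fun t => chart i (qinv (w t 0 i) *: w t)); split.
- by rewrite wi qinv1 scale1r w0.
- apply: filterS wn0 => t wt; exists (g t); first exact: SU2_circle.
  have [Vq _] := qmulV wt.
  rewrite chartK; last by rewrite mxE.
  by rewrite hline_scale // qinv_neq0.
- by apply: is_derive_chart; rewrite -/(w 0) w0 in dw.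
Qed.

(** The dimension count 3 = dim su(2) > 2 = dim M enters the proof here. *)
Lemma exists_kernel (x : 'M[R]_(3, 2)) :
  exists2 c : 'rV[R]_3, c != 0 & c *m x = 0.
Proof.
have : kermx x != 0.
  by rewrite -mxrank_eq0 mxrank_ker subn_eq0 -ltnNge ltnS rank_leq_col.
case/rowV0Pn => c cx c0; exists c => //.
exact/sub_kermxP.
Qed.

Lemma drho_sum_lin (x : 'rV[R]_3) :
  drhoS (0 +i* x 0 0) (x 0 1 +i* x 0 2) =
  qc (x 0 0)%:C *: drhoS (0 +i* 1) (0 +i* 0) +
  (qc (x 0 1)%:C *: drhoS (0 +i* 0) (1 +i* 0) +
   qc (x 0 2)%:C *: drhoS (0 +i* 0) (0 +i* 1)).
Proof.
have e1 : 0 +i* x 0 0 = (x 0 0)%:C * (0 +i* 1) +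
    ((x 0 1)%:C * (0 +i* 0) + (x 0 2)%:C * (0 +i* 0)) :> C.
  by apply/eqP; rewrite eq_complex /=; apply/andP; split; apply/eqP; ring.
have e2 : x 0 1 +i* x 0 2 = (x 0 0)%:C * (0 +i* 0) +
    ((x 0 1)%:C * (1 +i* 0) + (x 0 2)%:C * (0 +i* 1)) :> C.
  by apply/eqP; rewrite eq_complex /=; apply/andP; split; apply/eqP; ring.
apply: etrans (congr2 drhoS e1 e2) _.
apply: etrans (drho_sumD hN _ _ _ _) (congr2 +%R (drho_sumZ hN _ _ _) _).
apply: etrans (drho_sumD hN _ _ _ _) _.
exact: congr2 (drho_sumZ hN _ _ _) (drho_sumZ hN _ _ _).
Qed.

Lemma stabilizer_direction (i : 'I_n.+1) (z : 'rV[H]_n.+1)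
    (M : set (set 'rV[H]_n.+1)) :
  z 0 i = 1 -> (forall g, SU2 g -> M (hline (z *m rhoS g))) ->
  submanifold 2 [set x | M (hline (affine_point i x))] ->
  exists x1 x2 x3 q, x1 ^+ 2 + x2 ^+ 2 + x3 ^+ 2 = 1 :> R /\
    z *m drhoS (0 +i* x1) (x2 +i* x3) = q *: z.
Proof.
move=> zi Mz subM.
have SU2_1 : SU2 (1%:M : 'M[C]_2).
  rewrite -su2_1; apply/SU2P; exists 1, 0.
  by rewrite conjc1 conjc0 mul1r mul0r addr0.
have Mx : [set x | M (hline (affine_point i x))] (chart i z).
  by rewrite /= chartK // -[z]mulmx1 -(rho_sum1 R hN); exact: Mz.
have [L hL] := submanifold_tangent subM Mx.
have tangentL x1 x2 x3 : x1 ^+ 2 + x2 ^+ 2 + x3 ^+ 2 = 1 ->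
    exists u v, v = z *m drhoS (0 +i* x1) (x2 +i* x3) /\
      chart i (v - v 0 i *: z) = L u.
  move=> x; have [gamma [g0 gM gder]] := circle_chart_curve zi x.
  have gM' : \forall t \near (0 : R), M (hline (affine_point i (gamma t))).
    by apply: filterS gM => t [g gS ->]; exact: Mz.
  have [u hu] := hL gamma _ g0 gM' gder.
  by exists u; eexists; split; last exact: hu.
have [|u1 [v1 [e1 h1]]] := tangentL 1 0 0; first by ring.
have [|u2 [v2 [e2 h2]]] := tangentL 0 1 0; first by ring.
have [|u3 [v3 [e3 h3]]] := tangentL 0 0 1; first by ring.
(* The relation is taken between the parameters in R^2; [L] then carries it over to the
   velocities. *)
have [c c0 cu] := exists_kernel
  (\matrix_(k < 3) if k == 0 then u1 else if k == 1 then u2 else u3).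
have cu3 : c 0 0 *: u1 + (c 0 1 *: u2 + c 0 2 *: u3) = 0.
  move: cu; rewrite mulmx_sum_row !big_ord_recl big_ord0 !rowK /= addr0 => <-.
  by congr (c 0 _ *: _ + (c 0 _ *: _ + c 0 _ *: _)); apply/val_inj.
pose v := qc (c 0 0)%:C *: v1 + (qc (c 0 1)%:C *: v2 + qc (c 0 2)%:C *: v3).
have vE : z *m drhoS (0 +i* c 0 0) (c 0 1 +i* c 0 2) = v.
  have zD (A B D : 'M[H]_n.+1) (a b d : R) :
      z *m (qc a%:C *: A + (qc b%:C *: B + qc d%:C *: D)) =
      qc a%:C *: (z *m A) + (qc b%:C *: (z *m B) + qc d%:C *: (z *m D)).
    by rewrite !mulmxDr -!scalemxAr_real.
  rewrite /v e1 e2 e3 drho_sum_lin; exact: zD.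
pose q := v 0 i.
have T0 : v - q *: z = 0.
  apply: (@chart_inj R n i); first by rewrite /q !mxE zi mulr1 subrr.
  have -> : v - q *: z = qc (c 0 0)%:C *: (v1 - v1 0 i *: z) +
      (qc (c 0 1)%:C *: (v2 - v2 0 i *: z) +
       qc (c 0 2)%:C *: (v3 - v3 0 i *: z)).
    rewrite /q /v !mxE !scalerDl !scalerBr !scalerA !opprD.
    by rewrite (addrACA (_ *: v2)) (addrACA (_ *: v1)).
  rewrite !chartD !chartZ h1 h2 h3.
  transitivity (L (c 0 0 *: u1 + (c 0 1 *: u2 + c 0 2 *: u3))).
    by rewrite !linearD !linearZ.
  rewrite cu3 linear0.
  by apply/matrixP => k l; rewrite !mxE; case: l => -[|[|[|[|]]]].
have vq : z *m drhoS (0 +i* c 0 0) (c 0 1 +i* c 0 2) = q *: z.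
  by rewrite vE; apply/eqP; rewrite -subr_eq0 T0.
(* It remains to scale c to a unit vector; a real factor is central and merely multiplies q. *)
pose r2 := c 0 0 ^+ 2 + c 0 1 ^+ 2 + c 0 2 ^+ 2.
have r2P : 0 < r2.
  rewrite lt_neqAle !addr_ge0 ?sqr_ge0 // andbT eq_sym.
  rewrite !paddr_eq0 ?addr_ge0 ?sqr_ge0 //.
  rewrite !sqrf_eq0; apply/negP => /andP [/andP [/eqP k0 /eqP k1] /eqP k2].
  case/eqP: c0; apply/rowP => k; rewrite mxE -[RHS]k0.
  have : [|| k == 0, k == 1 | k == 2] by case: k => -[|[|[|]]].
  by move=> /or3P [] /eqP -> //; rewrite k0.
have r0 : 0 < (Num.sqrt r2)^-1 by rewrite invr_gt0 sqrtr_gt0.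
have rr : (Num.sqrt r2)^-1 ^+ 2 * r2 = 1.
  by rewrite exprVn sqr_sqrtr ?ltW // mulVf // gt_eqF.
move: (Num.sqrt r2)^-1 r0 rr => r r0 rr.
exists (r * c 0 0), (r * c 0 1), (r * c 0 2), (qc r%:C * q); split.
  by rewrite !exprMn -!mulrDr.
have f1 : 0 +i* (r * c 0 0) = r%:C * (0 +i* c 0 0).
  by apply/eqP; rewrite eq_complex /=; apply/andP; split; apply/eqP; ring.
have f2 : (r * c 0 1) +i* (r * c 0 2) = r%:C * (c 0 1 +i* c 0 2).
  by apply/eqP; rewrite eq_complex /=; apply/andP; split; apply/eqP; ring.
by rewrite f1 f2 drho_sumZ -scalemxAr_real vq scalerA.
Qed.

Lemma orbit_weight_vector (i : 'I_n.+1) (z : 'rV[H]_n.+1) x1 x2 x3 q :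
  z 0 i != 0 -> x1 ^+ 2 + x2 ^+ 2 + x3 ^+ 2 = 1 :> R ->
  z *m drhoS (0 +i* x1) (x2 +i* x3) = q *: z ->
  exists (h : 'M[C]_2) (w : 'rV[H]_n.+1) (lambda : nat) (c : 'I_s -> C),
    [/\ SU2 h, w != 0 /\ hline w = hline (z *m rhoS h),
        positive_weight m lambda &
        w = \sum_(a < s) qc (c a) *: uvec_sum R hN lambda a].
Proof.
move=> zi x zq; have [h hS hX] := circle_conj x.
(* Both sides are the derivative at t = 0 of one curve, by the conjugation identity [hX] and the
   multiplicativity of [rho_sum]. *)
have dX : drhoS (0 +i* x1) (x2 +i* x3) *m rhoS h = rhoS h *m drhoS 'i%C 0.
  apply: mxder_uniq (mxder_mulr (rhoS h) (mxder_circle x)) _.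
  have x100 : 1 ^+ 2 + 0 ^+ 2 + 0 ^+ 2 = 1 :> R by ring.
  have hd := mxder_mull (rhoS h) (mxder_circle x100).
  have e0 : 0 +i* 0 = 0 :> C by [].
  rewrite e0 in hd.
  have E t : rhoS h *m rhoS (su2 (circle_a 1 t) (circle_b 0 0 t)) =
      rhoS (su2 (circle_a x1 t) (circle_b x2 x3 t)) *m rhoS h.
    apply: etrans (esym (rho_sumM m_ge1 hN hS (SU2_circle t x100))) _.
    apply: etrans (congr1 _ (esym (hX t))) _.
    exact: rho_sumM (SU2_circle t x) hS.
  by rewrite (funext E) in hd.
pose y := z *m rhoS h.
have yq : y *m drhoS 'i%C 0 = q *: y.
  by rewrite /y -mulmxA -dX mulmxA zq scalemxAl.
have y0 : y != 0.
  apply/negP => /eqP y0.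
  have [g gS hg] : exists2 g : 'M[C]_2, SU2 g & h *m g = 1%:M.
    move/SU2P: hS => [a [b [ab ->]]]; exists (su2 (conjc a) (- b)).
      apply/SU2P; do 2 eexists; split; last reflexivity.
      by rewrite conjcK conjcN -ab; ring.
    by have [u <-] := su2_unit ab; rewrite mulmxV.
  have : z *m rhoS (h *m g) = 0 by rewrite rho_sumM // mulmxA -/y y0 mul0mx.
  by rewrite hg rho_sum1 mulmx1 => z0; move: zi; rewrite z0 mxE eqxx.
(* Any nonzero coordinate will do; its weight is the required lambda. *)
have [r yr] := rV0Pn _ y0.
have [Vq qV] := qmulV yr; have qi0 := qinv_neq0 yr.
pose w := qinv (y 0 r) *: y.
have wr : w 0 r = 1 by rewrite mxE.
(* Rescaling a vector on the left conjugates its left eigenvalue. *)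
have wq : w *m drhoS 'i%C 0 = (qinv (y 0 r) * q * y 0 r) *: w.
  by rewrite /w -scalemxAl yq !scalerA -[in RHS]mulrA qV mulr1.
have [c wc] := torus_eigenvector m_ge1 wr wq.
exists h, w, (weight hN r), c; split; [exact: hS| | |exact: wc].
  split; last exact: hline_scale.
  by apply/eqP => w0; move/eqP: wr; rewrite w0 mxE eq_sym oner_eq0.
split; first exact: weight_odd.
by exists (tagnat.sig1 (bidx hN r)); rewrite leq_subr.
Qed.

End Orbits.

Theorem theorem3p3 (R : realType) (n s : nat) (m : 'I_s -> nat)
    (m_ge1 : forall a, (1 <= m a)%N)
    (sum_m : (\sum_(a < s) m a)%N = n.+1)
    (M : set (set 'rV[quaternion R]_(n.+1))) :
  is_orbit (@rho_sum R s m n.+1 sum_m) M ->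
  HP_submanifold 2 M ->
  exists (z : 'rV[quaternion R]_(n.+1)) (lambda : nat) (c : 'I_s -> R[i]),
    [/\ z != 0, M (hline z), positive_weight m lambda &
        z = \sum_(a < s) quat_of_complex (c a) *: uvec_sum R sum_m lambda a].
Proof.
move=> [_ [z0 /= z0N0 <-] ->] [_ subM].
(* A nonzero coordinate of the base point selects the chart in which the smoothness of M is used. *)
have [i z0i] := rV0Pn _ z0N0.
have [Vq _] := qmulV z0i; have qi0 := qinv_neq0 z0i.
have zi : (qinv (z0 0 i) *: z0) 0 i = 1 by rewrite mxE.
move: subM; rewrite -(hline_scale z0 qi0); move: (_ *: z0) zi => z zi subM.
have Mz g : SU2 g ->
    [set [set w *m rho_sum sum_m g | w in hline z] | g in @SU2 R]
    (hline (z *m rho_sum sum_m g)).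
  by move=> gS; exists g => //; exact: hline_mulmx.
have [x1 [x2 [x3 [q [x zq]]]]] := stabilizer_direction zi Mz (subM i).
have zi0 : z 0 i != 0 by rewrite zi oner_neq0.
have [h [w [lambda [c [hS [w0 wh] wl wc]]]]] :=
  orbit_weight_vector m_ge1 zi0 x zq.
exists w, lambda, c; split; [exact: w0| |exact: wl|exact: wc].
by rewrite wh; exact: Mz.
Qed.
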